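(* Let $n\ge 1$. Let $T_0$ be a nonzero normal current of positive dimension $k_0$ in $\mathbb S^{N_0}$ without boundary, and for $i=1,\dots,n$ let $T_i$ be a nonzero integral current of positive dimension $k_i$ in $\mathbb S^{N_i}$ without boundary (the currents $T_0,\dots,T_n$ may or may not be stationary). Let $T=T_0\dot\times T_1\dot\times\cdots\dot\times T_n$ be their minimal product. Then the cone $C(T)\subset\mathbb R^{N_0+1}\oplus\cdots\oplus\mathbb R^{N_n+1}$ supports no globally defined continuous calibration; that is, there is no continuous calibration form of degree $k_0+k_1+\cdots+k_n+1$ on the whole space $\mathbb R^{N_0+1}\oplus\cdots\oplus\mathbb R^{N_n+1}$ which calibrates $C(T)$.
   Context: $\mathbb S^{N}$ denotes the unit sphere in $\mathbb R^{N+1}$. Currents are de Rham currents with compact support, and the boundary $dT$ is the adjoint of exterior differentiation. The comass of an $m$-form $\psi$ at $x$ is $\|\psi\|_x^*=\max\{\psi_x(\xi):\xi \text{ a unit simple } m\text{-vector at } x\}$, and the mass is $\mathbf M(T)=\sup\{T(\psi): \psi \text{ a smooth } m\text{-form},\ \sup_x\|\psi\|_x^*\le 1\}$. A normal current is one with $\mathbf M(T)<\infty$ and $\mathbf M(dT)<\infty$. Rectifiable currents are the closure of integral Lipschitz chains in the mass topology; an integral current is a rectifiable current with rectifiable boundary. A current of (locally) finite mass is written $T=\overrightarrow T\cdot\|T\|$, with $\|T\|$ a Radon measure and $\overrightarrow T_x$ an $m$-vector of unit mass norm (the norm dual to comass) for $\|T\|$-a.e. $x$. Minimal product: with $k=k_0+\cdots+k_n$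 and $\lambda_i=\sqrt{k_i/k}$, $T_0\dot\times\cdots\dot\times T_n=(\lambda_0T_0)\times\cdots\times(\lambda_nT_n)$, where $\lambda_iT_i$ denotes the push-forward of $T_i$ under the dilation $x\mapsto\lambda_ix$ and $\times$ is the Cartesian product of currents; it is a $k$-dimensional current supported in the unit sphere of $\mathbb R^{N_0+1}\oplus\cdots\oplus\mathbb R^{N_n+1}$. The cone $C(T)$ is the $(k+1)$-dimensional current of locally finite mass obtained by pushing forward $[0,\infty)\times T$ under $(t,x)\mapsto tx$ (the orientation convention is immaterial). A continuous calibration of degree $m$ on Euclidean space is a continuous $m$-form $\phi$ that is closed (in the sense of distributions) with $\sup_x\|\phi\|_x^*=1$. A current $S$ of locally finite mass is calibrated by $\phi$ (equivalently, $S$ supports $\phi$) if $\phi_x(\overrightarrow S_x)=1$ for $\|S\|$-a.e. $x$. Stationary means that the first variation of mass with respect to all compactly supported $C^1$ vector fields of the ambient space vanishes. *)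

(* Defs.v *)
From HB Require Import structures.
From mathcomp Require Import all_boot all_order all_algebra.
From mathcomp Require Import all_classical all_reals all_analysis.

Set Implicit Arguments.
Unset Strict Implicit.
Unset Printing Implicit Defensive.
Import Order.TTheory GRing.Theory Num.Theory.
Import numFieldNormedType.Exports.
Local Open Scope classical_set_scope.
Local Open Scope ring_scope.

(** * Multilinear algebra

    R^N is ['rV[R]_N].  An m-covector on R^N is an alternating m-linear
    function of the m rows of an [m x N] matrix, so that [v *m v^T] is the Gram
    matrix of the vectors [v] and [det (v *m v^T)] is the squared norm of the
    simple m-vector [v_1 /\ ... /\ v_m].  The norm that the library puts on
    ['rV[R]_N] is the max norm; it is used below only through its topology,
    its bounded sets and its Lipschitz maps, which are the Euclidean ones. *)

(* The two conditions are those of [determinant_multilinear] and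
   [determinant_alternate]. *)
Definition alternating (R : realType) (N m : nat) (f : 'M[R]_(m, N) -> R) :=
  (forall (A B C : 'M[R]_(m, N)) (i : 'I_m) (b c : R),
     row i A = b *: row i B + c *: row i C ->
     row' i B = row' i A -> row' i C = row' i A ->
     f A = b * f B + c * f C) /\
  (forall (A : 'M[R]_(m, N)) (i j : 'I_m),
     i != j -> row i A = row j A -> f A = 0).

(* The absolute value matters only for m = 0, where the unit simple 0-vectors
   are 1 and -1.  If m > N there is no unit simple m-vector, and [sup set0 = 0]. *)
Definition comass (R : realType) (N m : nat) (f : 'M[R]_(m, N) -> R) : R :=
  sup [set `|f v| | v in [set v : 'M[R]_(m, N) | \det (v *m v^T) = 1]].

(* m-vectors of R^N, by their coordinates in the basis
   e_I = e_(i_1) /\ ... /\ e_(i_m), with I = {i_1 < ... < i_m}. *)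
Definition subm (N m : nat) := {I : {set 'I_N} | #|I| == m}.
Definition mvec (R : realType) (N m : nat) := {ffun subm N m -> R}.

Definition basis_frame (R : realType) (N m : nat) (I : subm N m) :
    'M[R]_(m, N) :=
  rowsub (fun a : 'I_m =>
    enum_val (cast_ord (esym (eqP (valP I))) a)) (1%:M : 'M[R]_N).

Definition pairing (R : realType) (N m : nat)
    (f : 'M[R]_(m, N) -> R) (xi : mvec R N m) : R :=
  \sum_(I : subm N m) xi I * f (basis_frame R I).

Definition mass_norm (R : realType) (N m : nat) (xi : mvec R N m) : R :=
  sup [set pairing f xi
      | f in [set f : 'M[R]_(m, N) -> R | alternating f /\ comass f <= 1]].

(** * Differential forms *)

Definition dform (R : realType) (N m : nat) := 'rV[R]_N -> 'M[R]_(m, N) -> R.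

Definition iter_derive (R : realType) (N : nat) (us : seq 'rV[R]_N)
    (g : 'rV[R]_N -> R) : 'rV[R]_N -> R :=
  foldr (fun u h => fun x => 'D_u h x) g us.

Definition smooth (R : realType) (N : nat) (g : 'rV[R]_N -> R) :=
  forall us : seq 'rV[R]_N,
    continuous (iter_derive us g) /\
    forall u x, derivable (iter_derive us g) x u.

Definition smooth_form (R : realType) (N m : nat) (w : dform R N m) :=
  (forall x, alternating (w x)) /\ (forall v, smooth (fun x => w x v)).

Definition continuous_form (R : realType) (N m : nat) (w : dform R N m) :=
  (forall x, alternating (w x)) /\ (forall v, continuous (fun x => w x v)).

Definition compactly_supported (R : realType) (N m : nat) (w : dform R N m) :=
  exists r : R, forall x v, r < `|x| -> w x v = 0.

Definition extd (R : realType) (N m : nat) (w : dform R N m) : dform R N m.+1 :=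
  fun x v => \sum_(i < m.+1)
    (-1) ^+ i * 'D_(row i v) (fun y => w y (row' i v)) x.

Definition pullback (R : realType) (N N' m : nat)
    (f : 'rV[R]_N -> 'rV[R]_N') (w : dform R N' m) : dform R N m :=
  fun x v => w (f x) (\matrix_(i < m) 'D_(row i v) f x).

(** * Currents

    A functional on forms is a total function on [dform R N m]; only its values
    on smooth forms are meaningful. *)

Definition functional (R : realType) (N m : nat) := dform R N m -> R.

(* Linear, and continuous for the C^infinity topology on the space of all
   smooth forms; the latter means that T has compact support. *)
Definition is_current (R : realType) (N m : nat) (T : functional R N m) :=
  (forall (a : R) (w w' : dform R N m), smooth_form w -> smooth_form w' ->
     T (fun x v => a * w x v + w' x v) = a * T w + T w') /\
  (exists (r C : R) (s : nat), forall (w : dform R N m) (M : R),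
     smooth_form w ->
     (forall x v us, `|x| <= r -> `|v| <= 1 -> (size us <= s)%N ->
        all (fun u : 'rV[R]_N => `|u| <= 1) us ->
        `|iter_derive us (fun y => w y v) x| <= M) ->
     `|T w| <= C * M).

Definition nonzero_current (R : realType) (N m : nat) (T : functional R N m) :=
  exists w, smooth_form w /\ T w <> 0.

Definition mass (R : realType) (N m : nat) (T : functional R N m) : \bar R :=
  ereal_sup [set (T w)%:E
            | w in [set w | smooth_form w /\ forall x, comass (w x) <= 1]].

Definition boundary (R : realType) (N m : nat) (T : functional R N m.+1) :
    functional R N m :=
  fun w => T (extd w).

Definition pushforward (R : realType) (N N' m : nat)
    (f : 'rV[R]_N -> 'rV[R]_N') (T : functional R N m) : functional R N' m :=
  fun w => T (pullback f w).

(* T has no boundary *)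
Definition cycle_current (R : realType) (N m : nat)
    (T : functional R N m.+1) :=
  forall w, smooth_form w -> boundary T w = 0.

Definition unit_sphere (R : realType) (N : nat) : set 'rV[R]_N.+1 :=
  [set x | \sum_i x 0 i ^+ 2 = 1].

Definition supported_in (R : realType) (N m : nat)
    (T : functional R N m) (A : set 'rV[R]_N) :=
  forall w, smooth_form w ->
    (forall x, A x -> \forall y \near x, forall v, w y v = 0) -> T w = 0.

Definition normal_current (R : realType) (N m : nat)
    (T : functional R N m.+1) :=
  [/\ is_current T, (mass T < +oo)%E & (mass (boundary T) < +oo)%E].

(** * Rectifiable and integral currents *)

(* The Lebesgue integral over R^n, iterated (Fubini).  It is applied below to
   bounded Borel functions that vanish off a compact set. *)
Fixpoint intRn (R : realType) (n : nat) : ('rV[R]_n -> R) -> R :=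
  match n return ('rV[R]_n -> R) -> R with
  | 0 => fun g => g 0
  | n'.+1 => fun g => \int[@lebesgue_measure R]_t
      intRn (fun y : 'rV[R]_n' => g (row_mx (t%:M : 'rV[R]_1) y))
  end.

Definition std_simplex (R : realType) (m : nat) : set 'rV[R]_m :=
  [set x | (forall i, 0 <= x 0 i) /\ \sum_i x 0 i <= 1].

Definition simplex_current (R : realType) (m : nat) : functional R m m :=
  fun w => intRn (fun x => \1_(@std_simplex R m) x * w x 1%:M).

(* For Lipschitz f, the integrand of [pushforward f simplex_current] is
   defined almost everywhere by Rademacher's theorem. *)
Definition integral_lipschitz_chain (R : realType) (N m : nat)
    (S : functional R N m) :=
  exists (r : nat) (c : 'I_r -> int) (f : 'I_r -> 'rV[R]_m -> 'rV[R]_N),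
    (forall j, lipschitz (f j)) /\
    (forall w, smooth_form w ->
       S w = \sum_(j < r) (c j)%:~R * pushforward (f j) (@simplex_current R m) w).

Definition rectifiable_current (R : realType) (N m : nat)
    (T : functional R N m) :=
  is_current T /\
  forall eps : R, 0 < eps ->
    exists S, integral_lipschitz_chain S /\
      (mass (fun w => (T w - S w)%R) < eps%:E)%E.

Definition integral_current (R : realType) (N m : nat)
    (T : functional R N m.+1) :=
  rectifiable_current T /\ rectifiable_current (boundary T).

(** * Cartesian products, minimal products, cones *)

(* S x T is determined by (S x T)(p^*a /\ q^*b) = S(a) T(b) and continuity.
   As (p^*a /\ q^*b)((u_1,0),...,(u_m,0),(0,u'_1),...,(0,u'_m')) = a(u) b(u'),
   this is obtained by letting T act on the second variable, then S on the
   first. *)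
Definition cross (R : realType) (N N' m m' : nat)
    (S : functional R N m) (T : functional R N' m') :
    functional R (N + N') (m + m') :=
  fun w => S (fun x u => T (fun y u' =>
    w (row_mx x y) (block_mx u 0 0 u'))).

(* d_0 + (d_1 + (... + d_n)) *)
Fixpoint dsum (n : nat) : ('I_n.+1 -> nat) -> nat :=
  match n return ('I_n.+1 -> nat) -> nat with
  | 0 => fun d => d ord0
  | n'.+1 => fun d => (d ord0 + dsum (fun i => d (lift ord0 i)))%N
  end.

Fixpoint cross_family (R : realType) (n : nat) :
    forall d k : 'I_n.+1 -> nat,
      (forall i, functional R (d i) (k i)) ->
      functional R (dsum d) (dsum k) :=
  match n return forall d k : 'I_n.+1 -> nat,
      (forall i, functional R (d i) (k i)) ->
      functional R (dsum d) (dsum k) with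
  | 0 => fun d k T => T ord0
  | n'.+1 => fun d k T =>
      cross (T ord0) (cross_family (fun i => T (lift ord0 i)))
  end.

Definition dilate (R : realType) (N m : nat) (a : R) (T : functional R N m) :
    functional R N m :=
  pushforward (fun x => a *: x) T.

Definition minimal_product (R : realType) (n : nat) (d k : 'I_n.+1 -> nat)
    (T : forall i, functional R (d i) (k i)) :
    functional R (dsum d) (dsum k) :=
  cross_family (fun i =>
    dilate (Num.sqrt ((k i)%:R / (\sum_(j < n.+1) k j)%N%:R)) (T i)).

Definition halfline (R : realType) : functional R 1 1 :=
  fun w => \int[@lebesgue_measure R]_(t in `[0, +oo[) w t%:M 1%:M.

(* Meaningful on smooth compactly supported forms, for T supported in the unit
   sphere. *)
Definition cone (R : realType) (N m : nat) (T : functional R N m) :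
    functional R N m.+1 :=
  pushforward (fun z : 'rV[R]_(1 + N) => lsubmx z 0 0 *: rsubmx z)
    (cross (@halfline R) T).

(** * Calibrations *)

(* dw = 0 in the sense of distributions: each coefficient of dw, computed with
   distributional derivatives of the coefficients of w, vanishes. *)
Definition weakly_closed (R : realType) (N m : nat) (w : dform R N m) :=
  forall (g : 'rV[R]_N -> R) (v : 'M[R]_(m.+1, N)),
    smooth g -> (exists r : R, forall x, r < `|x| -> g x = 0) ->
    \sum_(i < m.+1) (-1) ^+ i *
      intRn (fun x => w x (row' i v) * 'D_(row i v) g x) = 0.

Definition continuous_calibration (R : realType) (N m : nat)
    (phi : dform R N m) :=
  [/\ continuous_form phi, weakly_closed phi &
      ereal_sup [set (comass (phi x))%:E | x in setT] = 1%E].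

Definition borelRn (R : realType) (N : nat) :=
  g_sigma_algebraType (@open 'rV[R]_N).

(* S = xi . mu, i.e. mu = ||S|| and xi is the orienting m-vector field of S;
   here S acts on smooth compactly supported forms. *)
Definition polar_decomposition (R : realType) (N m : nat)
    (S : functional R N m) (mu : {measure set (borelRn R N) -> \bar R})
    (xi : 'rV[R]_N -> mvec R N m) :=
  [/\ (forall K : set 'rV[R]_N, compact K -> (mu K < +oo)%E),
      (forall I, measurable_fun setT (fun x : borelRn R N => xi x I)),
      {ae mu, forall x, mass_norm (xi x) = 1} &
      forall w, smooth_form w -> compactly_supported w ->
        S w = \int[mu]_x pairing (w x) (xi x)].

Definition calibrates (R : realType) (N m : nat) (phi : dform R N m)
    (S : functional R N m) :=
  exists (mu : {measure set (borelRn R N) -> \bar R})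
         (xi : 'rV[R]_N -> mvec R N m),
    polar_decomposition S mu xi /\
    {ae mu, forall x, pairing (phi x) (xi x) = 1}.

(* Main.v *)
(** Let [phi] calibrate the cone S of P x Q, where P is the factor of [T_0] and Q the
    product of the others, and let [phi_0] be the value of [phi] at the origin.  For a
    cutoff [g] that is a product of radial functions, [S(g phi_0)] is an integral over
    t >= 0 of terms in which one of P, Q is applied to a form with constant coefficients;
    these vanish, as P and Q have no boundary.  On a small ball [phi] is close to [phi_0],
    so that [<phi_0, xi> >= 1/2] almost everywhere there and [S(g phi_0) = 0] forces ||S||
    to vanish near the origin.  On the other hand S is a cone: testing it against forms
    [c(x) d(|x_0|^2) /\ dx_I /\ dx_J] supported near the origin, and using that P is
    tangent to the sphere (since it has finite mass and no boundary), one recovers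
    P x Q <> 0. *)

Require Import Defs.
From HB Require Import structures.
From mathcomp Require Import all_boot all_order all_algebra all_fingroup.
From mathcomp Require Import all_classical all_reals all_analysis.
From mathcomp Require Import measurable_realfun ring lra zify.
Import Defs.

Set Implicit Arguments.
Unset Strict Implicit.
Unset Printing Implicit Defensive.
Import Order.TTheory GRing.Theory Num.Theory.
Import numFieldNormedType.Exports.
Local Open Scope classical_set_scope.
Local Open Scope ring_scope.

(** * Multilinear algebra *)

(** Freezing phi at the origin serves two ends. As phi is merely continuous, g phi is not an
    admissible test form, whereas g phi_0 is smooth. And the contraction of the constant covector
    phi_0 with the position vector is linear in the position: each coordinate belongs to one factor,
    so the other factor meets a constant covector, up to the cutoff. The cutoff of the first
    variable is constant on the sphere carrying P; that of the second is 1 on the support of the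
    last factor of Q as long as t <= t0. The first cutoff has the smaller scale, so that for t > t0
    it has already vanished on the sphere of P.

    A product of currents is an iteration of functionals, and smooth dependence of the inner value
    on the outer variable is not immediate. The forms tested on products are therefore finite sums
    of product functions times constant covectors, on which the inner functional returns a constant
    covector again. P enters through its restriction to a sphere, where its finite mass is used; Q,
    itself a product, enters through [tame], an interface stable under products. *)

Section Multilinear.
Variables (R : realType).

Lemma row'_eqP m n (i : 'I_m) (A B : 'M[R]_(m, n)) :
  row' i A = row' i B <-> forall j, j != i -> row j A = row j B.
Proof.
split=> [AB j ji|AB].
  rewrite eq_sym in ji; have [k jk _] := unlift_some ji; rewrite jk.
  by apply/rowP => l; have /matrixP/(_ k l) := AB; rewrite !mxE.
apply/matrixP => k l; rewrite !mxE.
have ki : lift i k != i by rewrite eq_sym neq_lift.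
by have /rowP/(_ l) := AB _ ki; rewrite !mxE.
Qed.

Definition multilinear m N (f : 'M[R]_(m, N) -> R) :=
  forall (A B C : 'M[R]_(m, N)) (i : 'I_m) (b c : R),
     row i A = b *: row i B + c *: row i C ->
     (forall j, j != i -> row j B = row j A) ->
     (forall j, j != i -> row j C = row j A) ->
     f A = b * f B + c * f C.

Lemma alternatingP m N (f : 'M[R]_(m, N) -> R) : alternating f <->
  multilinear f /\
  (forall (A : 'M[R]_(m, N)) (i j : 'I_m),
     i != j -> row i A = row j A -> f A = 0).
Proof.
split=> -[f1 f2]; split=> // A B C i b c r1 r2 r3; apply: (f1 _ _ _ i) => //;
  exact/row'_eqP.
Qed.

(* [L] transforms each row linearly and may insert constant rows. *)
Lemma alternating_comp m N m' N' (f : 'M[R]_(m', N') -> R)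
    (L : 'M[R]_(m, N) -> 'M[R]_(m', N')) (io : 'I_m -> 'I_m')
    (B : 'M[R]_(N, N')) :
  injective io ->
  (forall i A, row (io i) (L A) = row i A *m B) ->
  (forall j A A', j \notin codom io -> row j (L A) = row j (L A')) ->
  alternating f -> alternating (fun v => f (L v)).
Proof.
move=> io_inj L1 L2 /alternatingP[f1 f2]; apply/alternatingP; split.
  move=> A A1 A2 i b c r1 r2 r3.
  have H X : (forall j, j != i -> row j X = row j A) ->
      forall j, j != io i -> row j (L X) = row j (L A).
    move=> XA j ji; have [/codomP[k jk]|jc] := boolP (j \in codom io).
      by rewrite jk !L1 XA//; apply: contraNneq ji => <-; rewrite jk.
    exact: L2.
  apply: (f1 _ _ _ (io i)); [|exact: H|exact: H].
  by rewrite !L1 r1 mulmxDl !scalemxAl.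
move=> A i j ij rij; apply: (f2 _ (io i) (io j)).
  by apply: contra_neq ij => /io_inj.
by rewrite !L1 rij.
Qed.

Lemma alternating0 m N : alternating (fun _ : 'M[R]_(m, N) => 0 : R).
Proof. by split=> // *; rewrite !mulr0 addr0. Qed.

Lemma alternatingZD m N (a : R) (f g : 'M[R]_(m, N) -> R) :
  alternating f -> alternating g -> alternating (fun v => a * f v + g v).
Proof.
move=> [f1 f2] [g1 g2]; split=> [A B C i b c r1 r2 r3|A i j ij r].
  rewrite (f1 A B C i b c)// (g1 A B C i b c)//; ring.
by rewrite (f2 A i j)// (g2 A i j)// mulr0 addr0.
Qed.

Lemma alternatingZ m N (a : R) (f : 'M[R]_(m, N) -> R) :
  alternating f -> alternating (fun v => a * f v).
Proof.
move=> fa; have := alternatingZD a fa (alternating0 m N).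
by under eq_fun do rewrite addr0.
Qed.

Lemma alternating_sum m N I (r : seq I) (c : I -> R) (f : I -> 'M[R]_(m, N) -> R) :
  (forall i, alternating (f i)) ->
  alternating (fun v => \sum_(i <- r) c i * f i v).
Proof.
move=> fa; elim: r => [|i r IH].
  by under eq_fun do rewrite big_nil; apply: alternating0.
by under eq_fun do rewrite big_cons; apply: alternatingZD.
Qed.

(** The covector dx_{s 0} /\ ... /\ dx_{s (m-1)}. The map [s] is arbitrary, so indices need not be
    sorted, and a repeated index gives 0. *)
Definition dx m N (s : 'I_m -> 'I_N) (v : 'M[R]_(m, N)) : R :=
  \det (colsub s v).

Lemma dx_alternating m N (s : 'I_m -> 'I_N) : alternating (dx s).
Proof.
split=> [A B C i b c r1 r2 r3|A i j ij r].
  have H X : row' i X = row' i A ->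
      row' i (colsub s X) = row' i (colsub s A).
    by move=> /matrixP XA; apply/matrixP=> k l; have := XA k (s l); rewrite !mxE.
  apply: (determinant_multilinear (i0 := i)); [|exact: H|exact: H].
  by apply/rowP=> l; have /rowP/(_ (s l)) := r1; rewrite !mxE.
apply: (determinant_alternate ij) => l.
by have /rowP/(_ (s l)) := r; rewrite !mxE.
Qed.

Lemma dxZ m N (s : 'I_m -> 'I_N) (a : R) v : dx s (a *: v) = a ^+ m * dx s v.
Proof.
rewrite /dx -detZ; congr (\det _).
by apply/matrixP => i j; rewrite !mxE.
Qed.

Definition fcons m (T : Type) (l : T) (s : 'I_m -> T) (i : 'I_m.+1) : T :=
  oapp s l (unlift ord0 i).

Lemma fcons0 m T (l : T) (s : 'I_m -> T) : fcons l s ord0 = l.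
Proof. by rewrite /fcons unlift_none. Qed.

Lemma fconsS m T (l : T) (s : 'I_m -> T) i : fcons l s (lift ord0 i) = s i.
Proof. by rewrite /fcons liftK. Qed.

(** Expansion of dx_l /\ dx_s along the first column; the signs are those of [extd]. *)
Lemma dx_fcons m N l (s : 'I_m -> 'I_N) (v : 'M[R]_(m.+1, N)) :
  dx (fcons l s) v = \sum_(i < m.+1) (-1) ^+ i * (v i l * dx s (row' i v)).
Proof.
rewrite /dx (expand_det_col _ ord0); apply: eq_bigr => i _.
rewrite mxE fcons0 /cofactor addn0 mulrCA; congr (_ * (_ * \det _)).
by apply/matrixP => j k; rewrite !mxE fconsS.
Qed.

(* Interior product of [dx s] with the vector [x]. *)
Lemma dx_col_mx m N (s : 'I_m.+1 -> 'I_N) (x : 'rV[R]_N) (v : 'M[R]_(m, N)) :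
  dx s (col_mx x v : 'M[R]_(1 + m, N)) =
  \sum_(i < m.+1) (-1) ^+ i * (x 0 (s i) * dx (fun j => s (lift i j)) v).
Proof.
rewrite /dx (expand_det_row _ ord0); apply: eq_bigr => i _.
have -> : colsub s (col_mx x v : 'M[R]_(1 + m, N)) ord0 i = x 0 (s i).
  have -> : ord0 = lshift m (ord0 : 'I_1) by exact/val_inj.
  by rewrite [LHS]mxE [LHS]col_mxEu.
rewrite /cofactor add0n mulrCA; congr (_ * (_ * \det _)).
apply/matrixP => j k; do 3 rewrite [LHS]mxE.
have -> : lift ord0 j = rshift 1 j by exact/val_inj.
by rewrite [LHS]col_mxEd mxE.
Qed.

(** Indices of p^*dx_s /\ q^*dx_s', where p and q are the two projections. *)
Definition fcat m N m' N' (s : 'I_m -> 'I_N) (s' : 'I_m' -> 'I_N')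
    (i : 'I_(m + m')) : 'I_(N + N') :=
  match fintype.split i with
  | inl j => lshift N' (s j)
  | inr j => rshift N (s' j)
  end.

Lemma dx_block m N m' N' (s : 'I_m -> 'I_N) (s' : 'I_m' -> 'I_N')
    (u : 'M[R]_(m, N)) (u' : 'M[R]_(m', N')) :
  dx (fcat s s') (block_mx u 0 0 u') = dx s u * dx s' u'.
Proof.
rewrite /dx -(det_ublock _ 0); congr (\det _).
apply/matrixP => i j; rewrite [LHS]mxE /fcat.
by case: (split_ordP i) => i' ->; case: (split_ordP j) => j' ->;
  rewrite ?(unsplitK (inl _)) ?(unsplitK (inr _))
    ?block_mxEul ?block_mxEur ?block_mxEdl ?block_mxEdr ?mxE.
Qed.

Lemma multilinear_col_mx m N (f : 'M[R]_(1 + m, N) -> R) (x : 'rV[R]_N) :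
  multilinear f -> multilinear (fun v : 'M[R]_(m, N) => f (col_mx x v)).
Proof.
move=> f1 A A1 A2 i b c r1 r2 r3; apply: (f1 _ _ _ (rshift 1 i)).
- by rewrite !rowKd.
- move=> j; case: (split_ordP j) => k ->{j} ki.
    by rewrite !rowKu.
  by rewrite !rowKd r2//; apply: contraNneq ki => ->.
- move=> j; case: (split_ordP j) => k ->{j} ki.
    by rewrite !rowKu.
  by rewrite !rowKd r3//; apply: contraNneq ki => ->.
Qed.

Lemma multilinear_col_mx_sum m N (f : 'M[R]_(1 + m, N) -> R) I (r : seq I)
    (c : I -> R) (x : I -> 'rV[R]_N) (v : 'M[R]_(m, N)) :
  multilinear f ->
  f (col_mx (\sum_(i <- r) c i *: x i) v) =
  \sum_(i <- r) c i * f (col_mx (x i) v).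
Proof.
move=> f1.
have HD a b y z : f (col_mx (a *: y + b *: z) v) =
    a * f (col_mx y v) + b * f (col_mx z v).
  have e1 (t : 'rV[R]_N) : row (lshift m ord0) (col_mx t v) = t.
    by rewrite rowKu row_id.
  have e2 (t t' : 'rV[R]_N) j : j != lshift m ord0 ->
      row j (col_mx t v) = row j (col_mx t' v).
    case: (split_ordP j) => k -> //; last by rewrite !rowKd.
    by rewrite ord1 eqxx.
  apply: (f1 _ _ _ (lshift m ord0)); first by rewrite !e1.
    by move=> j /e2; apply.
  by move=> j /e2; apply.
elim: r => [|i r IH]; last by rewrite !big_cons -IH -[X in _ + X]scale1r HD mul1r.
by rewrite !big_nil -(scale0r 0) -[_ *: _]addr0 -[X in _ + X](scale0r 0) HD !mul0r addr0.
Qed.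

Lemma multilinear_expand m N (f : 'M[R]_(m, N) -> R) (A : 'M[R]_(m, N)) :
  multilinear f ->
  f A = \sum_(s : {ffun 'I_m -> 'I_N}) (\prod_i A i (s i)) * f (rowsub s 1%:M).
Proof.
elim: m f A => [|m IH] f A f1.
  rewrite (eq_bigr (fun=> f A)) => [|s _]; last first.
    by rewrite big_ord0 mul1r; congr f; apply/matrixP => -[].
  by rewrite sumr_const card_ffun !card_ord expn0 mulr1n.
have -> : A = col_mx (row 0 A) (row' 0 A) :> 'M[R]_(1 + m, N).
  apply/matrixP => i j; rewrite mxE.
  case: (split_ordP (i : 'I_(1 + m))) => k -> /=; rewrite !mxE ?ord1.
    by congr (A _ j); exact/val_inj.
  by congr (A _ j); exact/val_inj.
rewrite {1}(row_sum_delta (row 0 A)) multilinear_col_mx_sum//.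
under eq_bigr => l _ do rewrite (IH _ _ (multilinear_col_mx _ f1)) mulr_sumr.
rewrite pair_big /=.
pose h (p : 'I_N * {ffun 'I_m -> 'I_N}) := [ffun i => fcons p.1 p.2 i].
pose g (s : {ffun 'I_m.+1 -> 'I_N}) := (s ord0, [ffun i => s (lift ord0 i)]).
have hg : cancel h g.
  move=> [l s]; rewrite /h /g ffunE fcons0; congr pair.
  by apply/ffunP => i; rewrite !ffunE fconsS.
have gh : cancel g h.
  move=> s; apply/ffunP => i; rewrite ffunE /g /=.
  by case: (unliftP ord0 i) => [j ->|->]; rewrite ?fconsS ?fcons0 ?ffunE.
rewrite [RHS](reindex h); last by exists g => ? _; [exact: hg|exact: gh].
apply: eq_bigr => -[l s] _ /=.
rewrite big_ord_recl /= ffunE fcons0 mulrA; congr (_ * _ * f _).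
- by rewrite [RHS]mxE; case: splitP => // j _; rewrite ord1.
- apply: eq_bigr => i _; rewrite ffunE fconsS [RHS]mxE.
  case: (split_ordP (lift ord0 i : 'I_(1 + m))) => k ik.
    by case: (k) (congr1 val ik) => -[].
  by have -> : k = i by apply/val_inj; have := congr1 val ik; rewrite /= /bump => /addnI.
- apply/matrixP => i j; rewrite !mxE ffunE.
  case: splitP => k ik; rewrite !mxE.
    rewrite (_ : i = ord0) ?fcons0; last by apply/val_inj; rewrite /= ik ord1.
    by rewrite ord1 eq_sym.
  by rewrite (_ : i = lift ord0 k) ?fconsS//; apply/val_inj; rewrite /= ik.
Qed.

(** Polarisation: [B x y] is [A] with rows i and j replaced by x and y, and f (B (x + y) (x + y)) =
    0 is expanded. *)
Lemma alternating_xrow m N (f : 'M[R]_(m, N) -> R) i j (A : 'M[R]_(m, N)) :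
  alternating f -> i != j -> f (xrow i j A) = - f A.
Proof.
move=> /alternatingP[f1 f2] ij.
pose B (x y : 'rV[R]_N) :=
  \matrix_k (if k == i then x else if k == j then y else row k A) : 'M[R]_(m, N).
have Bi x y : row i (B x y) = x by rewrite rowK eqxx.
have Bj x y : row j (B x y) = y by rewrite rowK eqxx (eq_sym j) (negPf ij).
have Bk x y k : k != i -> k != j -> row k (B x y) = row k A.
  by move=> ki kj; rewrite rowK (negPf ki) (negPf kj).
have BB x : f (B x x) = 0 by apply: (f2 _ i j); rewrite ?Bi ?Bj.
have D1 x x' y : f (B (x + x') y) = f (B x y) + f (B x' y).
  rewrite (f1 _ (B x y) (B x' y) i 1 1) ?mul1r// ?Bi ?scale1r//.
    by move=> k ki; rewrite !rowK (negPf ki).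
  by move=> k ki; rewrite !rowK (negPf ki).
have D2 x y y' : f (B x (y + y')) = f (B x y) + f (B x y').
  rewrite (f1 _ (B x y) (B x y') j 1 1) ?mul1r// ?Bj ?scale1r//.
    by move=> k ki; rewrite !rowK (negPf ki).
  by move=> k ki; rewrite !rowK (negPf ki).
have -> : A = B (row i A) (row j A).
  apply/row_matrixP => k; rewrite rowK.
  by case: eqVneq => [->//|_]; case: eqVneq => [->|].
have -> : xrow i j (B (row i A) (row j A)) = B (row j A) (row i A).
  apply/row_matrixP => k.
  have -> C : row k (xrow i j C) = row (tperm i j k) C.
    by apply/rowP => l; rewrite !mxE.
  case: tpermP => [->|->|/eqP ki /eqP kj]; first by rewrite Bj Bi.
    by rewrite Bj Bi.
  by rewrite !Bk.
have /eqP := BB (row i A + row j A).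
by rewrite D1 !D2 !BB add0r addr0 addrC addr_eq0 => /eqP.
Qed.

Lemma alternating_row_perm m N (f : 'M[R]_(m, N) -> R) (p : 'S_m) A :
  alternating f -> f (row_perm p A) = (-1) ^+ p * f A.
Proof.
move=> fa; have [ts -> /allP tsP] := prod_tpermP p.
elim: ts A tsP => [|t ts IH] A tsP.
  by rewrite big_nil row_perm1 odd_perm1 mul1r.
rewrite big_cons row_permM alternating_xrow //; last first.
  by apply: (tsP t); rewrite mem_head.
rewrite IH => [|u uts]; last by apply: tsP; rewrite inE uts orbT.
have t12 : t.1 != t.2 by apply: (tsP t); rewrite mem_head.
by rewrite odd_permM odd_tperm t12 signr_addb expr1 mulN1r mulNr.
Qed.

(** m! f v is the signed sum of f over the row permutations of v. Expanding each term over all maps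
    s and summing over the permutations first produces the determinants. The sum runs over all maps
    instead of increasing ones, whence the factor 1/m!. *)
Lemma alternating_expand m N (f : 'M[R]_(m, N) -> R) (v : 'M[R]_(m, N)) :
  alternating f ->
  f v = \sum_(s : {ffun 'I_m -> 'I_N}) f (rowsub s 1%:M) / m`!%:R * dx s v.
Proof.
move=> fa; have /alternatingP[f1 _] := fa.
have m0 : m`!%:R != 0 :> R by rewrite pnatr_eq0 -lt0n fact_gt0.
apply: (mulfI m0); rewrite mulr_sumr.
have -> : m`!%:R * f v = \sum_(p : 'S_m) (-1) ^+ p * f (row_perm p v).
  rewrite (eq_bigr (fun=> f v)) => [|p _].
    by rewrite sumr_const card_Sn mulr_natl.
  by rewrite alternating_row_perm// mulrA -signr_addb addbb mul1r.
under eq_bigr => p _ do rewrite (multilinear_expand _ f1) mulr_sumr.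
rewrite exchange_big /=; apply: eq_bigr => s _.
rewrite [m`!%:R * _]mulrA [m`!%:R * _]mulrC divfK// mulrC /dx -det_tr mulr_suml.
apply: eq_bigr => p _; rewrite mulrA; congr (_ * _ * _).
by apply: eq_bigr => i _; rewrite !mxE.
Qed.
End Multilinear.
Arguments dx_alternating {R m N} s.

(** * Smooth functions *)

Section Flat.
Variable R : realType.
Implicit Types p : {poly R}.

(** All polynomials p are taken together because differentiation only changes p, so that the family
    is closed under derivatives. *)
Definition flat p (x : R) : R := if 0 < x then p.[x^-1] * expR (- x^-1) else 0.

(** Monomial by monomial, from s^(i+2) <= (i+2)! exp s at s = 1/x. The exponent 2 is what makes the
    difference quotient at 0 tend to 0. *)
Lemma flat_quadratic p : exists2 C, 0 <= C & forall x, `|flat p x| <= C * x ^+ 2.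
Proof.
exists (\sum_(i < size p) `|p`_i| * (i.+2)`!%:R) => [|x].
  by apply: sumr_ge0 => i _; rewrite mulr_ge0.
rewrite /flat; case: ifPn => [x0|_]; last first.
  by rewrite normr0 mulr_ge0 ?sqr_ge0// sumr_ge0// => i _; rewrite mulr_ge0.
have s0 : 0 < x^-1 by rewrite invr_gt0.
rewrite -ler_pdivrMr ?exprn_gt0// normrM (ger0_norm (expR_ge0 _)) horner_coef.
rewrite -mulrA -[_ / x ^+ 2]mulrC; apply: le_trans (ler_wpM2r _ (ler_norm_sum _ _ _)) _.
  by rewrite mulr_ge0 ?expR_ge0// invr_ge0 sqr_ge0.
rewrite mulr_suml; apply: ler_sum => i _.
rewrite normrM -mulrA ler_wpM2l// ger0_norm ?exprn_ge0 ?(ltW s0)//.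
rewrite mulrA -exprVn -exprD addn2 expRN ler_pdivrMr ?expR_gt0//.
have := expR_ge1Dxn i.+1 (ltW s0); rewrite -ler_pdivrMl ?ltr0n ?fact_gt0// mulrC.
by apply: le_trans; rewrite lerDr.
Qed.

(** For x > 0 the derivative of p(1/x) exp(-1/x) is (p - p')(1/x) exp(-1/x) / x^2; at 0 the
    quadratic bound applies. *)
Lemma is_derive_flat p (x : R) :
  is_derive x 1 (flat p) (flat ('X^2 * (p - p^`())) x).
Proof.
have [x0|x0|->] := ltgtP x 0.
- rewrite {2}/flat ltNge (ltW x0) /=; apply: near_eq_is_derive (is_derive_cst 0 x 1).
  by apply: filterS (lt_nbhsl x0) => y y0; rewrite /flat ltNge (ltW y0).
- have xn0 : x != 0 by rewrite gt_eqF.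
  have dV : is_derive x 1 (fun y : R => y^-1) (- x^-1 ^+ 2).
    have did : derivable (id : R -> R) x 1 by exact: derivable_id.
    apply: DeriveDef; first exact: (derivableV xn0 did).
    by rewrite (deriveV xn0 did) derive_id exprVn /GRing.scale /= mulr1.
  have dp : is_derive x^-1 1 (horner p) p^`().[x^-1].
    apply: DeriveDef; first exact: derivable_horner.
    by rewrite -derive1E -derivE.
  have d1 : is_derive x 1 (fun y => p.[y^-1]) (- x^-1 ^+ 2 * p^`().[x^-1]).
    by rewrite mulrC; exact: (is_derive1_comp dp dV).
  have d2 : is_derive x 1 (fun y => expR (- y^-1)) (x^-1 ^+ 2 * expR (- x^-1)).
    have dN : is_derive x 1 (fun y : R => - y^-1) (x^-1 ^+ 2).
      by apply: is_derive_eq; rewrite opprK.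
    by rewrite mulrC; exact: (is_derive1_comp (is_derive_expR _) dN).
  have H := is_deriveM d1 d2; apply: (@near_eq_is_derive _ _ _ _ _ _ _ _ _
    (is_derive_eq H _)).
    by apply: filterS (lt_nbhsr x0) => y y0; rewrite /flat y0.
  by rewrite /flat x0 hornerM hornerD hornerN hornerXn /GRing.scale /=; ring.
- rewrite {2}/flat ltxx; have [C C0 fC] := flat_quadratic p.
  have f0 : flat p 0 = 0 by rewrite /flat ltxx.
  have lim0 : (h^-1 *: (flat p (h *: 1 + 0) - flat p 0) @[h --> 0^']) --> (0 : R).
    apply/cvgr0Pnorm_le => e e0; near=> h.
    have h0 : h != 0 by near: h; exact: nbhs_dnbhs_neq.
    rewrite f0 subr0 addr0 /GRing.scale /= mulr1 normrM normfV.
    rewrite ler_pdivrMl ?normr_gt0//.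
    apply: le_trans (fC h) _; rewrite -(real_normK (num_real h)) expr2 mulrA mulrC.
    rewrite ler_wpM2l//; have : `|h| <= e / (C + 1).
      by near: h; apply: dnbhs0_le; rewrite divr_gt0// ltr_wpDl.
    rewrite ler_pdivlMr ?ltr_wpDl// => /(le_trans _); apply.
    by rewrite mulrC ler_wpM2l// lerDl.
  by apply: DeriveDef; [apply/cvg_ex; exists 0|exact: cvg_lim].
Unshelve. all: by end_near. Qed.

Lemma continuous_flat p : continuous (flat p).
Proof.
move=> x; have [d _] := is_derive_flat p x.
exact/differentiable_continuous/derivable1_diffP.
Qed.

Lemma flat_ge0 x : 0 <= flat 1 x.
Proof. by rewrite /flat; case: ifP => // _; rewrite hornerC mul1r expR_ge0. Qed.

Lemma flat_gt0 x : 0 < x -> 0 < flat 1 x.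
Proof. by rewrite /flat => ->; rewrite hornerC mul1r expR_gt0. Qed.

Lemma flat_eq0 p x : x <= 0 -> flat p x = 0.
Proof. by rewrite /flat ltNge => ->. Qed.

(** A smooth step, equal to 1 up to 1 and to 0 from 2 on; the factors 2 in the cutoff scales below
    come from this. *)
Definition plateau (x : R) : R := flat 1 (2 - x) / (flat 1 (2 - x) + flat 1 (x - 1)).

Lemma plateau_den_gt0 x : 0 < flat 1 (2 - x) + flat 1 (x - 1).
Proof.
have [x2|x2] := ltP x 2.
  by rewrite ltr_pwDl ?flat_ge0// flat_gt0// subr_gt0.
by rewrite ltr_wpDl ?flat_ge0// flat_gt0//; lra.
Qed.

Lemma plateau_ge0 x : 0 <= plateau x.
Proof. by rewrite divr_ge0 ?flat_ge0// ltW// plateau_den_gt0. Qed.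

Lemma plateau_le1 x : plateau x <= 1.
Proof. by rewrite ler_pdivrMr ?plateau_den_gt0// mul1r lerDl flat_ge0. Qed.

Lemma plateau1 x : x <= 1 -> plateau x = 1.
Proof.
move=> x1; have := plateau_den_gt0 x; rewrite /plateau (@flat_eq0 1 (x - 1)); last lra.
by rewrite addr0 => h; rewrite divff// gt_eqF.
Qed.

Lemma plateau0 x : 2 <= x -> plateau x = 0.
Proof. by move=> x2; rewrite /plateau flat_eq0 ?mul0r//; lra. Qed.

End Flat.

(** * Closure properties of smooth functions *)

Section Smooth.
Variable R : realType.
Implicit Types N : nat.

Lemma smooth_continuous N (f : 'rV[R]_N -> R) : smooth f -> continuous f.
Proof. by move=> /(_ [::])[]. Qed.

Lemma smooth_derivable N (f : 'rV[R]_N -> R) x u : smooth f -> derivable f x u.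
Proof. by move=> /(_ [::])[_]; apply. Qed.

Lemma iter_derive_rcons N us u (f : 'rV[R]_N -> R) :
  iter_derive (rcons us u) f = iter_derive us (fun x => 'D_u f x).
Proof. by rewrite /iter_derive foldr_rcons. Qed.

Lemma smooth_derive N u (f : 'rV[R]_N -> R) :
  smooth f -> smooth (fun x => 'D_u f x).
Proof. by move=> sf us; rewrite -iter_derive_rcons; exact: sf. Qed.

(** Induction on the word of directions from its innermost end: removing that direction replaces f
    by a derivative, which is still in the class. *)
Lemma smooth_coind N (C : ('rV[R]_N -> R) -> Prop) :
  (forall f, C f -> continuous f /\ forall u,
     (forall x, derivable f x u) /\ C (fun x => 'D_u f x)) ->
  forall f, C f -> smooth f.
Proof.
move=> CC f Cf us; elim/last_ind: us f Cf => [|us u IH] f Cf.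
  by have [fc fd] := CC _ Cf; split=> // u; exact: (fd u).1.
by rewrite iter_derive_rcons; apply: IH; have [_ /(_ u)[]] := CC _ Cf.
Qed.

(* A class closed under directional derivatives, hence made of smooth functions. *)
Inductive smooth_gen N : ('rV[R]_N -> R) -> Prop :=
| sg_base f : smooth f -> smooth_gen f
| sg_cst c : smooth_gen (fun=> c)
| sg_coord i : smooth_gen (fun x => x 0 i)
| sg_add f g : smooth_gen f -> smooth_gen g -> smooth_gen (fun x => f x + g x)
| sg_mul f g : smooth_gen f -> smooth_gen g -> smooth_gen (fun x => f x * g x)
| sg_inv f : (forall x, f x != 0) -> smooth_gen f -> smooth_gen (fun x => (f x)^-1)
| sg_flat p f : smooth_gen f -> smooth_gen (fun x => flat p (f x)).

Lemma is_derive_coord N (u x : 'rV[R]_N) i :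
  is_derive x u (fun y : 'rV[R]_N => y 0 i) (u 0 i).
Proof.
apply: DeriveDef; first by apply: diff_derivable; exact: differentiable_coord.
apply: cvg_lim => //; apply: cvg_near_cst.
near=> h; rewrite /= !mxE addrK /GRing.scale /= mulKf//.
near: h; exact: nbhs_dnbhs_neq.
Unshelve. all: by end_near. Qed.

Lemma derive_coord N (u x : 'rV[R]_N) i : 'D_u (fun y : 'rV[R]_N => y 0 i) x = u 0 i.
Proof. by have [_ ->] := is_derive_coord u x i. Qed.

Lemma smooth_gen_ext N (g f : 'rV[R]_N -> R) :
  (forall x, f x = g x) -> smooth_gen g -> smooth_gen f.
Proof. by move=> /funext ->. Qed.

(** Only a directional derivative of f is given, so f is restricted to the line through x in
    direction u and the one-variable chain rule is applied there. *)
Lemma derive_comp1 N (h dh : R -> R) (f : 'rV[R]_N -> R) x u :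
  is_derive (f x) 1 h (dh (f x)) -> derivable f x u ->
  is_derive x u (fun y => h (f y)) (dh (f x) * 'D_u f x).
Proof.
move=> hd fd.
have E (g : 'rV[R]_N -> R) d : is_derive x u g d <->
    is_derive (0 : R) (1 : R) (fun t : R => g (t *: u + x)) d.
  have DE : 'D_u g x = 'D_(1 : R) (fun t : R => g (t *: u + x)) (0 : R).
    rewrite /derive; set g1 := fun h => h^-1 *: _; set g2 := fun h => h^-1 *: _.
    suff -> : g1 = g2 by [].
    by apply/funext => t; rewrite /g1 /g2 /= addr0 scale0r add0r [_%:A]mulr1.
  have DP := derivable1P g x u.
  by split=> -[e <-]; (apply: DeriveDef; [exact/DP|rewrite DE]).
apply/E; have /derivableP/E fd' := fd.
apply: (is_derive1_comp _ fd').
by rewrite scale0r add0r.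
Qed.

Lemma smooth_gen_step N (f : 'rV[R]_N -> R) : smooth_gen f ->
  continuous f /\ forall u,
     (forall x, derivable f x u) /\ smooth_gen (fun x => 'D_u f x).
Proof.
elim=> {f} [f sf|c|i|f g _ [fc fd] _ [gc gd]|f g gf [fc fd] gg [gc gd]|f f0 gf [fc
  fd]|p f gf [fc fd]].
- split=> [|u]; first exact: smooth_continuous.
  by split=> [x|]; [exact (smooth_derivable sf)|exact/sg_base/smooth_derive].
- split=> [|u]; first exact: cst_continuous.
  split=> [x|]; first by apply: derivable_cst.
  by apply: (smooth_gen_ext _ (sg_cst _ 0)) => x; apply: derive_cst.
- split=> [x|u]; first exact: coord_continuous.
  split=> [x|]; first by have [] := is_derive_coord u x i.
  by apply: (smooth_gen_ext _ (sg_cst _ (u 0 i))) => x; exact: derive_coord.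
- split=> [x|u]; first exact: (cvgD (fc x) (gc x)).
  have [fu Df] := fd u; have [gu Dg] := gd u.
  split=> [x|]; first by apply: derivableD.
  by apply: (smooth_gen_ext _ (sg_add Df Dg)) => x; apply: (deriveD (fu x) (gu x)).
- split=> [x|u]; first exact: (cvgM (fc x) (gc x)).
  have [fu Df] := fd u; have [gu Dg] := gd u.
  split=> [x|]; first by apply: derivableM.
  apply: (smooth_gen_ext _ (sg_add (sg_mul gf Dg) (sg_mul gg Df))) => x.
  exact: (deriveM (fu x) (gu x)).
- split=> [x|u]; first exact: (cvgV (f0 x) (fc x)).
  have [fu Df] := fd u.
  split=> [x|]; first by apply: derivableV.
  have gV := sg_inv f0 gf.
  apply: (smooth_gen_ext _ (sg_mul (sg_mul (sg_cst _ (-1)) (sg_mul gV gV)) Df)) => x.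
  by rewrite [LHS](deriveV (f0 x) (fu x)) mulN1r -invfM -expr2.
- split=> [x|u]; first by apply: continuous_comp; [exact: fc|exact: continuous_flat].
  have [fu Df] := fd u.
  have H x := derive_comp1 (is_derive_flat p (f x)) (fu x).
  split=> [x|]; first by have [] := H x.
  by apply: (smooth_gen_ext _ (sg_mul (sg_flat _ gf) Df)) => x; have [_ ->] := H x.
Unshelve. all: by end_near. Qed.

Lemma smooth_genP N (f : 'rV[R]_N -> R) : smooth f <-> smooth_gen f.
Proof.
split; first exact: sg_base.
by apply: smooth_coind => g; exact: smooth_gen_step.
Qed.

Lemma smooth_cst N c : smooth (fun _ : 'rV[R]_N => c).
Proof. exact/smooth_genP/sg_cst. Qed.

Lemma smooth_coord N i : smooth (fun x : 'rV[R]_N => x 0 i).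
Proof. exact/smooth_genP/sg_coord. Qed.

Lemma smoothD N (f g : 'rV[R]_N -> R) :
  smooth f -> smooth g -> smooth (fun x => f x + g x).
Proof. by move=> /sg_base ? /sg_base ?; apply/smooth_genP/sg_add. Qed.

Lemma smoothM N (f g : 'rV[R]_N -> R) :
  smooth f -> smooth g -> smooth (fun x => f x * g x).
Proof. by move=> /sg_base ? /sg_base ?; apply/smooth_genP/sg_mul. Qed.

Lemma smoothZ N c (f : 'rV[R]_N -> R) : smooth f -> smooth (fun x => c * f x).
Proof. by move=> sf; apply: smoothM => //; exact: smooth_cst. Qed.

Lemma smoothB N (f g : 'rV[R]_N -> R) :
  smooth f -> smooth g -> smooth (fun x => f x - g x).
Proof.
move=> sf sg; have := smoothD sf (smoothZ (-1) sg).
by under eq_fun do rewrite mulN1r.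
Qed.

Lemma smooth_sum N I (r : seq I) (f : I -> 'rV[R]_N -> R) :
  (forall i, smooth (f i)) -> smooth (fun x => \sum_(i <- r) f i x).
Proof.
move=> sf; elim: r => [|i r IH].
  by under eq_fun do rewrite big_nil; exact: smooth_cst.
by under eq_fun do rewrite big_cons; exact: smoothD.
Qed.

Lemma smooth_plateau N (f : 'rV[R]_N -> R) :
  smooth f -> smooth (fun x => plateau (f x)).
Proof.
move=> /sg_base sf; apply/smooth_genP.
have s1 : smooth_gen (fun x => flat 1 (2 - f x)).
  apply: sg_flat; apply: sg_add; first exact: sg_cst.
  by apply: (smooth_gen_ext _ (sg_mul (sg_cst _ (-1)) sf)) => x; rewrite mulN1r.
apply: (sg_mul s1); apply: sg_inv => [x|].
  by rewrite gt_eqF// plateau_den_gt0.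
by apply: sg_add => //; apply: sg_flat; apply: sg_add => //; exact: sg_cst.
Qed.

(* No chain rule is needed: the difference quotients correspond. *)
Lemma smooth_comp_linear N N' (f : 'rV[R]_N' -> R) (L : 'rV[R]_N -> 'rV[R]_N') :
  continuous L -> (forall (h : R) u x, L (h *: u + x) = h *: L u + L x) ->
  smooth f -> smooth (fun x => f (L x)).
Proof.
move=> Lc Ll sf; pose C g := exists2 h, smooth h & g = (fun x => h (L x)).
apply: (@smooth_coind _ C); last by exists f.
move=> _ [h sh ->]; split=> [x|u].
  apply: continuous_comp; [exact: Lc|exact: smooth_continuous].
have DE x : (fun k : R => k^-1 *: (((fun y => h (L y)) \o shift x) (k *: u) - h (L x))) =
    (fun k : R => k^-1 *: ((h \o shift (L x)) (k *: L u) - h (L x))).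
  by apply/funext => k /=; rewrite Ll.
split=> [x|]; first by rewrite /derivable DE; exact (smooth_derivable sh).
exists (fun y => 'D_(L u) h y); first exact: smooth_derive.
by apply/funext => x; rewrite /derive DE.
Qed.

(** The squared Euclidean norm, which is smooth; [|x|] is the max norm. *)
Definition nsq N (x : 'rV[R]_N) := \sum_i x 0 i ^+ 2.

Lemma smooth_nsq N : smooth (@nsq N).
Proof.
apply: smooth_sum => i; under eq_fun do rewrite expr2.
by apply: smoothM; exact: smooth_coord.
Qed.

Lemma nsqZ N c (x : 'rV[R]_N) : nsq (c *: x) = c ^+ 2 * nsq x.
Proof. by rewrite /nsq mulr_sumr; apply: eq_bigr => i _; rewrite mxE exprMn. Qed.

Lemma nsq_ge0 N (x : 'rV[R]_N) : 0 <= nsq x.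
Proof. by apply: sumr_ge0 => i _; rewrite sqr_ge0. Qed.

Lemma coord_le_norm N (x : 'rV[R]_N) i : `|x 0 i| <= `|x|.
Proof. by rewrite /Num.norm/= mx_normrE; apply: (le_bigmax _ _ (0, i)). Qed.

Lemma nsq_le N (x : 'rV[R]_N) : nsq x <= N%:R * `|x| ^+ 2.
Proof.
rewrite -[N in N%:R]card_ord -sum1_card natr_sum mulr_suml.
apply: ler_sum => i _; rewrite mul1r -[x 0 i ^+ 2](real_normK (num_real _)).
by rewrite lerXn2r ?nnegrE// coord_le_norm.
Qed.

Lemma norm_le_nsq N (x : 'rV[R]_N) : `|x| ^+ 2 <= nsq x.
Proof.
have [x0|x0] := eqVneq x 0; first by rewrite x0 normr0 expr0n nsq_ge0.
have nx : mx_norm x != 0 by rewrite -[mx_norm x]/(`|x|) normr_eq0.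
have [[k i]] := mx_norm_neq0 nx.
rewrite ord1 /= -[mx_norm x]/(`|x|) => ->; rewrite (real_normK (num_real _)).
by rewrite /nsq (bigD1 i)//= lerDl sumr_ge0// => j _; rewrite sqr_ge0.
Qed.

End Smooth.

(** * Linearity of derivatives in the direction; effect of dilations *)

Section DirectionalDerivatives.
Variable R : realType.
Implicit Types N : nat.

Lemma derive_line N (f : 'rV[R]_N -> R) (v y : 'rV[R]_N) (t : R) :
  derivable f (t *: v + y) v ->
  is_derive t 1 (fun s : R => f (s *: v + y)) ('D_v f (t *: v + y)).
Proof.
have E : (fun h : R => h^-1 *: (((fun s : R => f (s *: v + y)) \o shift t) (h *: 1)
    - f (t *: v + y))) =
  (fun h : R => h^-1 *: ((f \o shift (t *: v + y)) (h *: v) - f (t *: v + y))).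
  by apply/funext => h /=; rewrite [_%:A]mulr1 scalerDl addrA.
by move=> fd; apply: DeriveDef; rewrite /derivable /derive E.
Qed.

Lemma derive_mvt N (f : 'rV[R]_N -> R) (v y : 'rV[R]_N) (h : R) : smooth f ->
  exists2 th, `|th| <= `|h| & f (h *: v + y) - f y = h * 'D_v f (th *: v + y).
Proof.
move=> sf; pose g (s : R) := f (s *: v + y).
have gd (t : R) : is_derive t 1 g ('D_v f (t *: v + y)).
  exact: derive_line (smooth_derivable sf).
have gc (A : set R) : {within A, continuous g}.
  apply: continuous_subspaceT => t.
  by have [d _] := gd t; exact/differentiable_continuous/derivable1_diffP.
have g0 : g 0 = f y by rewrite /g scale0r add0r.
rewrite -[f (h *: v + y)]/(g h) -g0.
have [h0|h0|->] := ltgtP h 0; last by exists 0; rewrite ?normr0// subrr mul0r.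
- have [c /itvP cI E] := MVT h0 (fun x _ => gd x) (gc _).
  exists c; first by rewrite (ler0_norm (ltW h0)) ler0_norm ?cI// lerN2 cI.
  by apply: oppr_inj; rewrite opprB E sub0r mulrC mulNr.
- have [c /itvP cI E] := MVT h0 (fun x _ => gd x) (gc _).
  exists c; first by rewrite (ger0_norm (ltW h0)) ger0_norm ?cI// cI.
  by rewrite E subr0 mulrC.
Qed.

(** Since [smooth] speaks of directional derivatives alone, additivity has to be proved: move by h u
    and then by h v, apply the mean value theorem to the second leg, and use the continuity of the
    derivative in direction v. *)
Lemma derive_dirD N (f : 'rV[R]_N -> R) (u v x : 'rV[R]_N) : smooth f ->
  'D_(u + v) f x = 'D_u f x + 'D_v f x.
Proof.
move=> sf; apply: cvg_lim => //.
have E h : h^-1 *: ((f \o shift x) (h *: (u + v)) - f x) =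
    h^-1 * (f (h *: u + x) - f x) + h^-1 * (f (h *: v + (h *: u + x)) - f (h *: u + x)).
  have -> : (f \o shift x) (h *: (u + v)) = f (h *: v + (h *: u + x)).
    by rewrite /= scalerDr (addrC (h *: u)) -addrA.
  by rewrite -mulrDr; congr (_ * _); ring.
under eq_fun do rewrite E.
apply: cvgD; first exact: (smooth_derivable sf).
have Dc : {for x, continuous (fun y => 'D_v f y)}.
  exact/smooth_continuous/smooth_derive.
apply/cvgrPdist_le => e e0.
move/cvgrPdist_le : Dc => /(_ e e0)/nbhs_normP[d /= d0 Hd].
near=> h.
have h0 : h != 0 by near: h; exact: nbhs_dnbhs_neq.
have [th thh ->] := derive_mvt v (h *: u + x) h sf.
rewrite mulKf//; apply: Hd => /=.
rewrite /ball_/= addrA opprD addrCA subrr addr0 normrN.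
apply: le_lt_trans (ler_normD _ _) _; rewrite !normrZ.
have K0 : 0 < `|v| + `|u| + 1 by rewrite ltr_wpDl// addr_ge0.
have : `|h| < d / (`|v| + `|u| + 1).
  by near: h; apply: dnbhs0_lt; rewrite divr_gt0.
rewrite ltr_pdivlMr//; apply: le_lt_trans.
rewrite !mulrDr mulr1 -[leLHS]addr0 lerD// lerD//.
by rewrite ler_wpM2r.
Unshelve. all: by end_near. Qed.

Lemma derive_dirZ N (f : 'rV[R]_N -> R) c (u x : 'rV[R]_N) : smooth f ->
  'D_(c *: u) f x = c * 'D_u f x.
Proof.
move=> sf.
have /derive_line fl : derivable f ((c * 0) *: u + x) u by exact: (smooth_derivable sf).
have cl : is_derive (0 : R) (1 : R) (fun s : R => c * s) c.
  by apply: is_derive_eq; rewrite ?mulr1// /GRing.scale /= mulr1.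
have [_ E2] := is_derive1_comp fl cl.
have /derive_line [_ E1] : derivable f (0 *: (c *: u) + x) (c *: u).
  exact: (smooth_derivable sf).
rewrite mulr0 !scale0r !add0r in E1 E2; rewrite mulrC -E2 -E1.
rewrite (_ : (fun s : R => f (s *: (c *: u) + x)) =
  (fun s : R => f (s *: u + x)) \o (fun s : R => c * s))//.
by apply/funext => s /=; rewrite scalerA mulrC.
Qed.

Lemma derive_dir_sum N (f : 'rV[R]_N -> R) (u x : 'rV[R]_N) : smooth f ->
  'D_u f x = \sum_l u 0 l * 'D_(delta_mx 0 l) f x.
Proof.
move=> sf; rewrite {1}(row_sum_delta u).
elim/big_ind2 : _ => [|a a' b b' <- <-|l _]; first exact: derive0.
  exact: derive_dirD.
exact: derive_dirZ.
Qed.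

(** d(c dx_s) = dc /\ dx_s, with dc expanded in the coordinate directions by linearity in the
    direction. *)
Lemma extd_dx N m (s : 'I_m -> 'I_N) (c : 'rV[R]_N -> R) : smooth c ->
  extd (fun x (v : 'M[R]_(m, N)) => c x * dx s v) =
  (fun x v => \sum_l 'D_(delta_mx 0 l) c x * dx (fcons l s) v).
Proof.
move=> sc; apply/funext => x; apply/funext => v; rewrite /extd.
under [RHS]eq_bigr => l _ do rewrite dx_fcons mulr_sumr.
rewrite exchange_big /=; apply: eq_bigr => i _.
have -> : 'D_(row i v) (fun y => c y * dx s (row' i v)) x =
    dx s (row' i v) * 'D_(row i v) c x.
  have := @deriveMr R _ c (dx s (row' i v)) x (row i v) (smooth_derivable sc).
  by rewrite /GRing.scale /= => <-.
rewrite derive_dir_sum// !mulr_sumr; apply: eq_bigr => l _; rewrite mxE; ring.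
Qed.

Lemma iter_derive0 N us : iter_derive us (fun _ : 'rV[R]_N => 0 : R) = fun=> 0.
Proof.
elim: us => //= u us ->; apply/funext => x; exact: derive_cst.
Qed.

Lemma iter_deriveZD N us a (f g : 'rV[R]_N -> R) : smooth f -> smooth g ->
  iter_derive us (fun x => a * f x + g x) =
  fun x => a * iter_derive us f x + iter_derive us g x.
Proof.
elim/last_ind: us f g => [//|us u IH] f g sf sg.
rewrite !iter_derive_rcons -IH; [|exact: smooth_derive..].
congr (iter_derive us _); apply/funext => x.
have sf' : derivable (a *: f) x u by apply: derivableZ; exact: smooth_derivable.
rewrite -[LHS]/('D_u (a *: f + g) x) deriveD//; last exact: smooth_derivable.
by rewrite deriveZ//; exact: smooth_derivable.
Qed.

Lemma iter_deriveZ N us a (f : 'rV[R]_N -> R) : smooth f ->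
  iter_derive us (fun x => a * f x) = fun x => a * iter_derive us f x.
Proof.
move=> sf; have := iter_deriveZD us a sf (smooth_cst (N := N) 0).
rewrite iter_derive0; under eq_fun do rewrite addr0; move=> ->.
by under eq_fun do rewrite addr0.
Qed.

Lemma iter_derive_sum N us I (r : seq I) (c : I -> R) (f : I -> 'rV[R]_N -> R) :
  (forall i, smooth (f i)) ->
  iter_derive us (fun x => \sum_(i <- r) c i * f i x) =
  fun x => \sum_(i <- r) c i * iter_derive us (f i) x.
Proof.
move=> sf; elim: r => [|i r IH].
  by under eq_fun do rewrite big_nil; rewrite iter_derive0;
    under [RHS]eq_fun do rewrite big_nil.
under eq_fun do rewrite big_cons; rewrite iter_deriveZD//; last first.
  by apply: smooth_sum => j; exact: smoothZ.
by rewrite IH; under [RHS]eq_fun do rewrite big_cons.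
Qed.

Lemma iter_derive_near0 N us (f : 'rV[R]_N -> R) (x : 'rV[R]_N) :
  (\forall y \near x, f y = 0) -> \forall y \near x, iter_derive us f y = 0.
Proof.
move=> f0; elim: us => [//|u us IH] /=.
have /nbhs_interior := IH; apply: filterS => y yU.
have : \forall z \near y, iter_derive us f z = (fun=> 0) z by apply: yU.
by move=> /near_eq_derive ->; rewrite derive_cst.
Qed.

Lemma compact_cball N (r : R) : compact [set x : 'rV[R]_N | `|x| <= r].
Proof.
apply: bounded_closed_compact.
  exists r; split; first exact: num_real.
  by move=> M rM x /= xr; rewrite (le_trans xr)// ltW.
rewrite (_ : [set _ | _] = Num.norm @^-1` [set t : R | t <= r])//.
by apply: closed_comp => [x _|]; [exact: norm_continuous|exact: closed_le].
Qed.

Lemma smooth_dilation N (c : R) (h : 'rV[R]_N -> R) :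
  smooth h -> smooth (fun y => h (c *: y)).
Proof.
apply: (@smooth_comp_linear _ _ _ _ (fun y => c *: y)).
  exact: scaler_continuous.
by move=> k u y; rewrite scalerDr !scalerA mulrC.
Qed.

(** Each derivative of t^m f(t y) brings out one more factor t, so m is general in the induction on
    the order. At order 0 the uniformity in x comes from compactness of the ball; at each further
    order the N coordinate directions share the error e. *)
Lemma iter_derive_dilation_cvg N us_size m (f : 'rV[R]_N -> R) (r t0 e : R) :
  smooth f -> 0 < e ->
  \forall t \near t0, forall us x, size us = us_size ->
    all (fun u : 'rV[R]_N => `|u| <= 1) us -> `|x| <= r ->
    `|iter_derive us (fun y => t ^+ m * f (t *: y) - t0 ^+ m * f (t0 *: y)) x| <= e.
Proof.
elim: us_size m f e => [|n IH] m f e sf e0.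
  have /compact_near_coveringP/(_ R (nbhs t0)) := @compact_cball N r.
  pose P (t : R) (x : 'rV[R]_N) := `|t ^+ m * f (t *: x) - t0 ^+ m * f (t0 *: x)| <= e.
  move=> /(_ P _) H; have {}H : \near t0, [set x : 'rV[R]_N | `|x| <= r] `<=` P t0.
    apply: H => x0 _.
    have fc := smooth_continuous sf.
    have s1 : fst @ nbhs (x0, t0) --> x0 by exact: cvg_fst.
    have s2 : snd @ nbhs (x0, t0) --> t0 by exact: cvg_snd.
    have a1 : p.2 ^+ m @[p --> (x0, t0)] --> t0 ^+ m.
      have H := @continuous_cvg _ R R _ _ _ (fun t : R => t ^+ m) t0 _ s2.
      by apply: H; exact: exprn_continuous.
    have a2 : f (p.2 *: p.1) @[p --> (x0, t0)] --> f (t0 *: x0).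
      have z : p.2 *: p.1 @[p --> (x0, t0)] --> t0 *: x0 by exact: cvgZ.
      have H := @continuous_cvg _ _ _ _ _ _ f _ (fc _) z.
      by apply: H.
    have a3 : f (t0 *: p.1) @[p --> (x0, t0)] --> f (t0 *: x0).
      have z : t0 *: p.1 @[p --> (x0, t0)] --> t0 *: x0.
        by apply: cvgZ => //; exact: cvg_cst.
      have H := @continuous_cvg _ _ _ _ _ _ f _ (fc _) z.
      by apply: H.
    have c1 : (p.2 ^+ m * f (p.2 *: p.1) - t0 ^+ m * f (t0 *: p.1))
        @[p --> (x0, t0)] --> (0 : R).
      rewrite -[X in _ --> X](subrr (t0 ^+ m * f (t0 *: x0))).
      by apply: cvgB; [exact: cvgM|apply: cvgM => //; exact: cvg_cst].
    by move/cvgr0Pnorm_le : c1 => /(_ e e0).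
  by apply: filterS H => t Pt [|//] x _ _ xr; exact: Pt.
have K0 : 0 < e / (N%:R + 1) by rewrite divr_gt0// ltr_wpDl.
pose Q (l : 'I_N) (t : R) := forall us x, size us = n ->
    all (fun u : 'rV[R]_N => `|u| <= 1) us -> `|x| <= r ->
    `|iter_derive us (fun y => t ^+ m.+1 * 'D_(delta_mx 0 l) f (t *: y)
       - t0 ^+ m.+1 * 'D_(delta_mx 0 l) f (t0 *: y)) x| <= e / (N%:R + 1).
have : \forall t \near t0, forall l, Q l t.
  apply: (@filter_forall R 'I_N Q (nbhs t0)) => l.
  exact: (IH m.+1 _ _ (smooth_derive (delta_mx 0 l) sf) K0).
apply: filterS => t Ht us x; case/lastP: us => [//|us u].
rewrite size_rcons all_rcons => -[sn] /andP[u1 us1] xr.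
have sc (c : R) (h : 'rV[R]_N -> R) := @smooth_dilation N c h.
have sd (c : R) (h : 'rV[R]_N -> R) y : smooth h ->
    'D_u (fun y => c ^+ m * h (c *: y)) y =
      \sum_l u 0 l * (c ^+ m.+1 * 'D_(delta_mx 0 l) h (c *: y)).
  move=> sh; have -> : 'D_u (fun y => c ^+ m * h (c *: y)) y =
    c ^+ m * 'D_(c *: u) h (c *: y).
    have E := @deriveZ R _ _ (fun y =>
      h (c *: y)) (c ^+ m) y u (smooth_derivable (sc c h sh)).
    rewrite [LHS]E; congr (_ * _).
    rewrite /derive; set g1 := fun h => h^-1 *: _; set g2 := fun h => h^-1 *: _.
    suff -> : g1 = g2 by [].
    by apply/funext => k; rewrite /g1 /g2 /= [c *: (_ + _)]scalerDr !scalerA (mulrC c).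
  rewrite derive_dirZ// derive_dir_sum// !mulr_sumr.
  by apply: eq_bigr => l _; rewrite exprSr; ring.
rewrite iter_derive_rcons.
have -> : (fun y => 'D_u (fun z => t ^+ m * f (t *: z) - t0 ^+ m * f (t0 *: z)) y) =
    (fun y => \sum_l u 0 l * (t ^+ m.+1 * 'D_(delta_mx 0 l) f (t *: y)
       - t0 ^+ m.+1 * 'D_(delta_mx 0 l) f (t0 *: y))).
  apply/funext => y.
  have d c : derivable (fun z => c ^+ m * f (c *: z)) y u.
    by apply: smooth_derivable; apply: smoothZ; exact: sc.
  have := deriveB (d t) (d t0); rewrite !sd// => ->.
  by rewrite -sumrB; apply: eq_bigr => l _; rewrite mulrBr.
rewrite iter_derive_sum => [|l]; last first.
  have s1 (c : R) := smoothZ (c ^+ m.+1) (sc c _ (smooth_derive (delta_mx 0 l) sf)).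
  have := smoothD (s1 t) (smoothZ (-1) (s1 t0)).
  by under eq_fun do rewrite mulN1r.
apply: le_trans (ler_norm_sum _ _ _) _.
apply: (@le_trans _ _ (\sum_(l < N) e / (N%:R + 1))).
  apply: ler_sum => l _; rewrite normrM -[leRHS]mul1r ler_pM//.
    by rewrite (le_trans (coord_le_norm u l)).
  exact: Ht.
rewrite sumr_const card_ord -[_ / _ *+ _]mulr_natl mulrCA ler_piMr ?(ltW e0)//.
by rewrite ler_pdivrMr ?ltr_wpDl// mul1r lerDl.
Qed.

End DirectionalDerivatives.

(** * Currents on products of functions and constant covectors *)

Section Currents.
Variable R : realType.
Implicit Types N m : nat.

Lemma alternating_bounded N m (ka : 'M[R]_(m, N) -> R) : alternating ka ->
  exists2 B : R, 0 <= B & forall v, `|v| <= 1 -> `|ka v| <= B.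
Proof.
move=> /alternatingP[k1 _].
exists (\sum_(s : {ffun 'I_m -> 'I_N}) `|ka (rowsub s 1%:M)|) => [|v v1].
  by apply: sumr_ge0.
rewrite (multilinear_expand v k1); apply: le_trans (ler_norm_sum _ _ _) _.
apply: ler_sum => s _; rewrite normrM ler_piMl// normr_prod.
apply: prodr_ile1 => i _; rewrite normr_ge0 /= (le_trans _ v1)//.
by rewrite [leRHS]/Num.norm/= mx_normrE; apply: (le_bigmax _ _ (i, s i)).
Qed.

Lemma smooth_form_cst N m (f : 'rV[R]_N -> R) (ka : 'M[R]_(m, N) -> R) :
  smooth f -> alternating ka -> smooth_form (fun x v => f x * ka v).
Proof.
move=> sf ak; split=> [x|v]; first exact: alternatingZ.
by under eq_fun do rewrite mulrC; exact: smoothZ.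
Qed.

Lemma smooth_form_sum N m I (r : seq I) (c : I -> R) (f : I -> 'rV[R]_N -> R)
    (ka : I -> 'M[R]_(m, N) -> R) :
  (forall i, smooth (f i)) -> (forall i, alternating (ka i)) ->
  smooth_form (fun x v => \sum_(i <- r) c i * (f i x * ka i v)).
Proof.
move=> sf ak; split=> [x|v].
  by apply: alternating_sum => i; exact: alternatingZ.
apply: smooth_sum => i; apply: smoothZ.
by under eq_fun do rewrite mulrC; exact: smoothZ.
Qed.

Definition linear_on N m (D : set ('rV[R]_N -> R)) (Q : functional R N m) :=
  forall I (r : seq I) (c : I -> R) (f : I -> 'rV[R]_N -> R)
    (ka : I -> 'M[R]_(m, N) -> R),
  (forall i, D (f i)) -> (forall i, alternating (ka i)) ->
  Q (fun x v => \sum_(i <- r) c i * (f i x * ka i v)) =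
  \sum_(i <- r) c i * Q (fun x v => f i x * ka i v).

Section Current.
Variables (N m : nat) (T : functional R N m).
Hypothesis Tc : is_current T.

Lemma current0 : T (fun _ _ => 0) = 0.
Proof.
have [Tl _] := Tc; have s0 : smooth_form (fun (_ : 'rV[R]_N) (_ : 'M[R]_(m, N)) => 0 : R).
  by split=> [x|v]; [exact: alternating0|exact: smooth_cst].
have := Tl (-1) _ _ s0 s0.
have -> : (fun (x : 'rV[R]_N) (v : 'M[R]_(m, N)) => -1 * 0 + 0) = (fun _ _ => 0 : R).
  by apply/funext => x; apply/funext => v; rewrite mulr0 addr0.
by rewrite mulN1r addNr.
Qed.

Lemma current_linear : linear_on (@smooth R N) T.
Proof.
move=> I r c f ka sf ak; elim: r => [|i r IH].
  by rewrite big_nil -[RHS]current0; congr T; apply/funext => x; apply/funext => v;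
    rewrite big_nil.
have [Tl _] := Tc; rewrite big_cons -IH -Tl;
  [|exact: smooth_form_cst|exact: smooth_form_sum].
by congr T; apply/funext => x; apply/funext => v; rewrite big_cons.
Qed.

Lemma currentZ a (f : 'rV[R]_N -> R) ka : smooth f -> alternating ka ->
  T (fun x v => a * (f x * ka v)) = a * T (fun x v => f x * ka v).
Proof.
move=> sf ak; have := current_linear [:: tt] (fun=> a) (fun=> sf) (fun=> ak).
rewrite big_seq1 => <-; congr T; apply/funext => x; apply/funext => v.
by rewrite big_seq1.
Qed.

Lemma currentB (f g : 'rV[R]_N -> R) ka : smooth f -> smooth g -> alternating ka ->
  T (fun x v => (f x - g x) * ka v) =
  T (fun x v => f x * ka v) - T (fun x v => g x * ka v).
Proof.
move=> sf sg ak; have [Tl _] := Tc.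
have := Tl (-1) _ _ (smooth_form_cst sg ak) (smooth_form_cst sf ak).
rewrite mulN1r addrC => <-; congr T; apply/funext => x; apply/funext => v.
by rewrite mulrBl mulN1r addrC.
Qed.

Lemma current_le : exists (r C : R) (n : nat), 0 <= C /\ forall f ka (B M : R),
  smooth f -> alternating ka -> (forall v, `|v| <= 1 -> `|ka v| <= B) ->
  0 <= B -> 0 <= M ->
  (forall us (x : 'rV[R]_N), (size us <= n)%N -> all (fun u : 'rV[R]_N => `|u| <= 1) us ->
     `|x| <= r -> `|iter_derive us f x| <= M) ->
  `|T (fun x v => f x * ka v)| <= C * B * M.
Proof.
have [_ [r [C [n TC]]]] := Tc; exists r, `|C|, n; split=> // f ka B M sf ak kB B0 M0 fM.
rewrite -mulrA; apply: (@le_trans _ _ (C * (B * M))); last first.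
  by rewrite ler_wpM2r ?mulr_ge0// ler_norm.
apply: TC => [|x v us xr v1 usn us1]; first exact: smooth_form_cst.
under eq_fun do rewrite mulrC.
by rewrite iter_deriveZ// normrM ler_pM// ?kB// fM.
Qed.

(** If f vanishes on the open ball of radius r + 1, all its derivatives vanish on the closed ball of
    radius r, and these control T. *)
Lemma current_local : exists r : R, forall f ka, smooth f -> alternating ka ->
  (forall x : 'rV[R]_N, `|x| < r -> f x = 0) -> T (fun x v => f x * ka v) = 0.
Proof.
have [r [C [n [C0 TC]]]] := current_le; exists (r + 1) => f ka sf ak f0.
have [B B0 kB] := alternating_bounded ak.
apply/eqP; rewrite -normr_le0; have := TC f ka B 0 sf ak kB B0 (lexx _).
rewrite !mulr0; apply => us x _ _ xr; rewrite normr_le0; apply/eqP.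
have xr1 : `|x| < r + 1 by rewrite (le_lt_trans xr)// ltrDl.
have fx : \forall y \near x, f y = 0.
  have H : \forall y \near x, `|y| < r + 1.
    have nc : `|y| @[y --> x] --> `|x| by exact: norm_continuous.
    exact: (cvgr_lt _ nc _ xr1).
  by apply: filterS H => y yr; exact: f0.
exact: (nbhs_singleton (iter_derive_near0 us fx)).
Qed.

(** The derivatives of f (t x) up to the order n of T depend continuously on t, uniformly on the
    ball that controls T. *)
Lemma current_dilation_continuous f ka : smooth f -> alternating ka ->
  continuous (fun t : R => T (fun x v => f (t *: x) * ka v)).
Proof.
move=> sf ak t0; have [r [C [n [C0 TC]]]] := current_le.
have [B B0 kB] := alternating_bounded ak.
apply/cvgrPdist_le => e e0.
have K0 : 0 < e / (C * B + 1) by rewrite divr_gt0// ltr_wpDl ?mulr_ge0.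
have : \forall t \near t0, forall i : 'I_n.+1, forall us x, size us = i ->
    all (fun u : 'rV[R]_N => `|u| <= 1) us -> `|x| <= r ->
    `|iter_derive us (fun y => f (t *: y) - f (t0 *: y)) x| <= e / (C * B + 1).
  pose Q (i : 'I_n.+1) t := forall us x, size us = i ->
    all (fun u : 'rV[R]_N => `|u| <= 1) us -> `|x| <= r ->
    `|iter_derive us (fun y => f (t *: y) - f (t0 *: y)) x| <= e / (C * B + 1).
  apply: (@filter_forall R _ Q (nbhs t0)) => i.
  have := iter_derive_dilation_cvg i 0 r t0 sf K0.
  have E t : (fun y => t ^+ 0 * f (t *: y) - t0 ^+ 0 * f (t0 *: y)) =
      (fun y => f (t *: y) - f (t0 *: y)).
    by apply/funext => y; rewrite !expr0 !mul1r.
  by apply: filterS => t; rewrite E.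
apply: filterS => t Ht.
have st c := smooth_dilation c sf.
rewrite distrC -(currentB (st t) (st t0) ak).
apply: (@le_trans _ _ (C * B * (e / (C * B + 1)))).
  apply: (TC _ _ _ _ (smoothB (st t) (st t0)) ak kB B0 (ltW K0)).
  move=> us x usn us1 xr.
  exact: (Ht (Ordinal (usn : (size us < n.+1)%N))).
rewrite mulrCA ler_piMr ?(ltW e0)// ler_pdivrMr ?ltr_wpDl ?mulr_ge0//.
by rewrite mul1r lerDl.
Qed.
End Current.

Section Cycle.
Variables (N m : nat) (T : functional R N m.+1).
Hypothesis Tc : is_current T.

(** Expand a form on which T is nonzero in the dx_s; by linearity T cannot vanish on all the
    terms. *)
Lemma current_nonzero_dx : nonzero_current T ->
  exists (s : 'I_m.+1 -> 'I_N) (f : 'rV[R]_N -> R),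
    smooth f /\ T (fun x v => f x * dx s v) != 0.
Proof.
move=> [w [[wa ws] w0]]; apply: contrapT => /forallNP H; apply: w0.
have -> : w = fun x v => \sum_(s : {ffun 'I_m.+1 -> 'I_N})
    (m.+1)`!%:R^-1 * (w x (rowsub s 1%:M) * dx s v).
  apply/funext => x; apply/funext => v; rewrite (alternating_expand v (wa x)).
  by apply: eq_bigr => s _; rewrite [RHS]mulrA; congr (_ * _); exact: mulrC.
rewrite (current_linear Tc (index_enum _) (fun=> _)
  (fun s : {ffun 'I_m.+1 -> 'I_N} => ws (rowsub s 1%:M))
  (fun s : {ffun 'I_m.+1 -> 'I_N} => dx_alternating s)).
rewrite big1// => s _; have /forallNP/(_ (fun x => w x (rowsub s 1%:M))) := H s.
move=> /not_andP[h|/negP]; first by case: (h (ws _)).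
by rewrite negbK => /eqP ->; rewrite mulr0.
Qed.

Hypothesis T_cycle : cycle_current T.

Lemma cycle_stokes (c : 'rV[R]_N -> R) (s : 'I_m -> 'I_N) : smooth c ->
  \sum_l T (fun x v => 'D_(delta_mx 0 l) c x * dx (fcons l s) v) = 0.
Proof.
move=> sc; have := T_cycle (smooth_form_cst sc (dx_alternating s)).
rewrite /boundary extd_dx// => E; rewrite -[RHS]E.
have := current_linear Tc (index_enum 'I_N) (fun=> 1)
  (fun l => smooth_derive (delta_mx 0 l) sc) (fun l => dx_alternating (fcons l s)).
under eq_bigr do rewrite mul1r; move=> <-.
congr T; apply/funext => x; apply/funext => v.
by apply: eq_bigr => l _; rewrite mul1r.
Qed.

(** In positive degree a constant form is exact: dx_s is d(x_{s 0} dx_{s'}), where s' is s without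
    its first index. *)
Lemma cycle_const ka : alternating ka -> T (fun _ v => ka v) = 0.
Proof.
have T1 s : T (fun _ v => dx s v) = 0.
  have := cycle_stokes (fun i => s (lift ord0 i)) (smooth_coord (s ord0)).
  rewrite (bigD1 (s ord0))//= big1 ?addr0 => [|l ls].
    move=> <-; congr T; apply/funext => x; apply/funext => v.
    rewrite derive_coord mxE !eqxx mul1r; congr (dx _ v); apply/funext => i.
    by case: (unliftP ord0 i) => [j|] ->; rewrite ?fconsS ?fcons0.
  rewrite -[RHS](current0 Tc); congr T; apply/funext => x; apply/funext => v.
  by rewrite derive_coord mxE eqxx eq_sym (negPf ls) mul0r.
move=> ak.
have -> : (fun (_ : 'rV[R]_N) v => ka v) = fun x v => \sum_(s : {ffun 'I_m.+1 -> 'I_N})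
    ka (rowsub s 1%:M) / (m.+1)`!%:R * (1 * dx s v).
  apply/funext => x; apply/funext => v; rewrite [LHS](alternating_expand v ak).
  by under [RHS]eq_bigr do rewrite mul1r.
rewrite (current_linear Tc) => [|s|s]; [|exact: smooth_cst|exact: dx_alternating].
rewrite big1// => s _; apply/eqP; rewrite mulf_eq0; apply/orP; right; apply/eqP.
by rewrite -[RHS](T1 s); congr T; apply/funext => x; apply/funext => v; rewrite mul1r.
Qed.
End Cycle.

Lemma comass_ge0 N m (ka : 'M[R]_(m, N) -> R) : 0 <= comass ka.
Proof.
have [[[x [v Ev xE]] ub]|/sup_out] := pselect (has_sup [set `|ka v| | v in [set v :
  'M[R]_(m, N) | \det (v *m v^T) = 1]]).
  apply: le_trans (ub_le_sup ub _); last by exists v.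
  by [].
by rewrite /comass => ->.
Qed.

(* Junk values do no harm: [sup] is 0 on unbounded sets. *)
Lemma comassZ_le N m a (ka : 'M[R]_(m, N) -> R) :
  comass (fun v => a * ka v) <= `|a| * comass ka.
Proof.
rewrite /comass; set A := [set v | _].
have [[[_ [v0 Av0 _]] [y yub]]|nA] := pselect (has_sup [set `|ka v| | v in A]).
  apply: ge_sup; first by exists `|a * ka v0|; exists v0.
  move=> _ [v Av <-]; rewrite normrM ler_wpM2l//.
  by apply: ub_le_sup; [exists y|exists v].
rewrite (sup_out nA) mulr0.
have [[[_ [v0 Av0 _]] [y yub]]|nB] := pselect (has_sup [set `|a * ka v| | v in A]);
  last first.
  by rewrite (sup_out nB).
have [->|a0] := eqVneq a 0.
  apply: ge_sup; first by exists `|0 * ka v0|; exists v0.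
  by move=> _ [v Av <-]; rewrite mul0r normr0.
exfalso; apply: nA; split; first by exists `|ka v0|; exists v0.
exists (`|a|^-1 * y) => _ [v Av <-]; rewrite ler_pdivlMl ?normr_gt0//.
by rewrite -normrM; apply: yub; exists v.
Qed.

(** * Cycles of finite mass on the unit sphere *)

Section FiniteMassCycle.
Variables (N m : nat) (T : functional R N.+1 m.+1).
Hypotheses (Tc : is_current T) (T_mass : (mass T < +oo)%E)
  (T_sphere : supported_in T (@unit_sphere R N)).

Lemma finite_mass_bound : exists2 M : R, 0 <= M & forall w, smooth_form w ->
  (forall x, comass (w x) <= 1) -> `|T w| <= M.
Proof.
have T0 : T (fun _ _ => 0) = 0 by exact: current0.
have s0 : smooth_form (fun (_ : 'rV[R]_N.+1) (_ : 'M[R]_(m.+1, N.+1)) => 0 : R).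
  by split=> [x|v]; [exact: alternating0|exact: smooth_cst].
have H w : smooth_form w -> (forall x, comass (w x) <= 1) -> ((T w)%:E <= mass T)%E.
  by move=> sw cw; apply: ereal_sup_ubound; exists w.
have m0 : (0 <= mass T)%E.
  rewrite -[0%E]/(0%:E) -T0; apply: H => // x.
  by have := comassZ_le 0 (fun _ : 'M[R]_(m.+1, N.+1) => 0); rewrite normr0 !mul0r =>
    /le_trans; apply.
have mfin : mass T \is a fin_num by rewrite ge0_fin_numE.
exists (fine (mass T)) => [|w sw cw]; first exact: fine_ge0.
rewrite ler_norml; apply/andP; split; last by rewrite -lee_fin fineK// H.
rewrite lerNl -lee_fin fineK//.
have -> : - T w = T (fun x v => -1 * w x v + 0).
  by have [Tl _] := Tc; rewrite (Tl (-1) w _ sw s0) T0 addr0 mulN1r.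
apply: H => [|x].
  have [wa ws] := sw; split=> [x|v].
    by under eq_fun do rewrite addr0; exact: alternatingZ.
  by under eq_fun do rewrite addr0; exact: smoothZ.
under eq_fun do rewrite addr0.
by rewrite (le_trans (comassZ_le _ _))// normrN normr1 mul1r.
Qed.

(** The support condition only concerns forms that vanish near the sphere, while the derivatives of
    h may be nonzero on it. Finite mass bridges the gap: h can be replaced, without change near the
    sphere, by a function g that is uniformly small everywhere. *)
Lemma finite_mass_sphere (h : 'rV[R]_N.+1 -> R) ka : smooth h -> alternating ka ->
  (forall x, unit_sphere x -> h x = 0) -> T (fun x v => h x * ka v) = 0.
Proof.
move=> sh ak h0; have [M M0 TM] := finite_mass_bound.
have c0 := comass_ge0 ka.
apply/eqP; rewrite -normr_le0; apply/ler_addgt0Pr => e e0; rewrite add0r.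
pose K := (comass ka + 1) * (M + 1).
have K0 : 0 < K by rewrite mulr_gt0// ltr_wpDl.
pose d := e / K; have d0 : 0 < d by rewrite divr_gt0.
(* The argument of the plateau is at most 1/2 where |h| < d/2, hence near the sphere, and at least 2
   where |h| > d. *)
pose g x := h x * plateau (2 / d ^+ 2 * h x ^+ 2).
have sg : smooth g.
  apply: (smoothM sh); apply: smooth_plateau; apply: smoothZ.
  by under eq_fun do rewrite expr2; exact: (smoothM sh sh).
have gd x : `|g x| <= d.
  have [hd|hd] := leP `|h x| d.
    rewrite normrM (ger0_norm (plateau_ge0 _)) (le_trans _ hd)//.
    by rewrite ler_piMr// plateau_le1.
  rewrite /g plateau0 ?mulr0 ?normr0 ?(ltW d0)//.
  rewrite -mulrA ler_peMr// ler_pdivlMl ?exprn_gt0// mulr1.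
  by rewrite -[h x ^+ 2](real_normK (num_real _)) lerXn2r ?nnegrE ?(ltW d0)// ltW.
have -> : T (fun x v => h x * ka v) = T (fun x v => g x * ka v).
  apply/eqP; rewrite -subr_eq0 -(currentB Tc sh sg ak); apply/eqP; apply: T_sphere.
    exact: (smooth_form_cst (smoothB sh sg) ak).
  move=> x xS; have hx := h0 x xS.
  have hc : `|h y| @[y --> x] --> `|h x|.
    have hcc := smooth_continuous sh.
    have hc0 : h y @[y --> x] --> h x by exact: hcc.
    exact: (cvg_norm hc0).
  have H : \forall y \near x, `|h y| < d / 2.
    by apply: (cvgr_lt _ hc); rewrite hx normr0 divr_gt0.
  apply: filterS H => y hy v; rewrite /g plateau1 ?mulr1 ?subrr ?mul0r//.
  rewrite mulrAC ler_pdivrMr ?exprn_gt0// mul1r.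
  have : `|h y| ^+ 2 <= (d / 2) ^+ 2 by rewrite lerXn2r ?nnegrE ?divr_ge0 ?(ltW d0)// ltW.
  rewrite (real_normK (num_real _)); have := sqr_ge0 d; nra.
(* Division by a d brings the comass of g ka to at most 1, so that |T (g ka)| <= a d M = e M / (M +
   1). *)
have a0 : 0 < comass ka + 1 by rewrite ltr_wpDl.
set a := comass ka + 1 in K K0 d d0 g sg gd a0 *.
have ad0 : 0 < a * d by rewrite mulr_gt0.
have {TM} : `|T (fun x v => (a * d)^-1 * (g x * ka v))| <= M.
  apply: TM => [|x].
    have -> : (fun x v => (a * d)^-1 * (g x * ka v)) =
        (fun x v => (a * d)^-1 * g x * ka v).
      by apply/funext => x; apply/funext => v; rewrite mulrA.
    exact: (smooth_form_cst (smoothZ _ sg) ak).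
  have -> : (fun v => (a * d)^-1 * (g x * ka v)) = (fun v => (a * d)^-1 * g x * ka v).
    by apply/funext => v; rewrite mulrA.
  apply: le_trans (comassZ_le _ _) _.
  rewrite normrM gtr0_norm ?invr_gt0// -mulrA ler_pdivrMl// mulr1 mulrC.
  by rewrite ler_pM// lerDl.
rewrite (currentZ Tc _ sg ak) normrM gtr0_norm ?invr_gt0//.
rewrite ler_pdivrMl// => /le_trans; apply.
rewrite /d /K.
have -> : a * (e / (a * (M + 1))) * M = e * (M / (M + 1)).
  have M1 : M + 1 != 0 by rewrite gt_eqF// ltr_wpDl.
  by field; rewrite M1 gt_eqF.
by rewrite ler_piMr ?(ltW e0)// ler_pdivrMr ?ltr_wpDl// mul1r lerDl.
Qed.

Hypothesis T_cycle : cycle_current T.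

(* The form [d(c (|x|^2 - 1) dx_s)] splits into a multiple of [|x|^2 - 1] and
   [2 c (x . dx) /\ dx_s]. *)
Lemma cycle_radial (c : 'rV[R]_N.+1 -> R) (s : 'I_m -> 'I_N.+1) : smooth c ->
  \sum_l T (fun x v => c x * x 0 l * dx (fcons l s) v) = 0.
Proof.
move=> sc; pose f (x : 'rV[R]_N.+1) := nsq x - 1.
have sf : smooth f by apply: smoothB; [exact: smooth_nsq|exact: smooth_cst].
have sl l := smooth_derive (delta_mx 0 l) sc.
have fl l x : 'D_(delta_mx 0 l) f x = 2 * x 0 l.
  have -> : f = (\sum_(i < N.+1) (fun y : 'rV[R]_N.+1 => y 0 i * y 0 i)) + cst (- 1).
    apply/funext => y; rewrite /f /nsq -[RHS]/(_ y + _) fct_sumE.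
    by under eq_bigr do rewrite expr2.
  have dM i : is_derive x (delta_mx 0 l) (fun y : 'rV[R]_N.+1 => y 0 i * y 0 i)
      (2 * x 0 i * (i == l)%:R).
    have di : derivable (fun y : 'rV[R]_N.+1 => y 0 i) x (delta_mx 0 l).
      exact: (smooth_derivable (smooth_coord i)).
    apply: DeriveDef; first exact: derivableM.
    rewrite [LHS](deriveM di di) derive_coord mxE eqxx /= /GRing.scale /=; ring.
  have [_ ->] := is_deriveD (is_derive_sum dM) (is_derive_cst (-1 : R) x (delta_mx 0 l)).
  rewrite addr0 (bigD1 l)//= eqxx mulr1 big1 ?addr0// => i /negPf ->.
  by rewrite mulr0.
have f0 x : unit_sphere x -> f x = 0 by move=> xS; rewrite /f /nsq xS subrr.
have := cycle_stokes Tc T_cycle s (smoothM sf sc).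
have -> : \sum_l T (fun x v => 'D_(delta_mx 0 l) (fun y =>
  f y * c y) x * dx (fcons l s) v) =
    2 * \sum_l T (fun x v => c x * x 0 l * dx (fcons l s) v).
  rewrite mulr_sumr; apply: eq_bigr => l _.
  have al : alternating (@dx R _ _ (fcons l s)) by exact: dx_alternating.
  have s1 : smooth (fun x => f x * 'D_(delta_mx 0 l) c x) by exact: (smoothM sf (sl l)).
  have s2 : smooth (fun x => c x * x 0 l) by exact: (smoothM sc (smooth_coord l)).
  have := current_linear Tc [:: true; false] (fun b : bool => if b then 1 else 2)
    (f := fun b : bool => if b then fun x =>
      f x * 'D_(delta_mx 0 l) c x else fun x => c x * x 0 l)
    (ka := fun=> dx (fcons l s)).
  rewrite !big_cons !big_nil (finite_mass_sphere s1 al); last first.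
    by move=> x xS; rewrite f0// mul0r.
  rewrite mulr0 add0r addr0 => <-; [|by case|by []].
  congr T; apply/funext => x; apply/funext => v.
  rewrite !big_cons !big_nil /= mul1r addr0 [2 * _]mulrA -mulrDl; congr (_ * _).
  rewrite [LHS](deriveM (smooth_derivable sf) (smooth_derivable sc)) fl /GRing.scale
    /=; ring.
by move/eqP; rewrite mulf_eq0 pnatr_eq0 /= => /eqP.
Qed.
End FiniteMassCycle.
End Currents.

(** * Dilations and products of currents *)

Section Tame.
Variable R : realType.
Implicit Types N m : nat.

Definition cutoff N (e : R) (g : 'rV[R]_N -> R) :=
  [/\ forall x, 0 <= g x <= 1,
      exists2 d : R, 0 < d & forall x, `|x| <= d -> g x = 1
    & forall x, e <= `|x| -> g x = 0].

(* Linearity is required only on the finite sums [\sum_j f_j kappa_j] with [f_j] in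
   [D] and [kappa_j] constant; for products of currents this avoids
   differentiation under the integral sign. *)
Record tame N m (Q : functional R N m) (D : set ('rV[R]_N -> R)) : Prop := Tame {
  tame_smooth : forall f, D f -> smooth f;
  tame_dilation : forall f c, D f -> D (fun x => f (c *: x));
  tame_coord : forall f l, D f -> D (fun x => x 0 l * f x);
  tame_linear : linear_on D Q;
  tame_cutoff : forall e, 0 < e -> exists t0 g, [/\ 0 < t0, D g, cutoff e g &
    forall t ka, 0 <= t <= t0 -> alternating ka ->
      Q (fun x v => g (t *: x) * ka v) = 0];
  tame_nonzero : exists f (s : 'I_m -> 'I_N), [/\ D f,
    exists r : R, forall x, r < `|x| -> f x = 0,
    continuous (fun t : R => Q (fun x v => f (t *: x) * dx s v)) &
    Q (fun x v => f x * dx s v) != 0] }.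

Lemma linear_onZ N m (Q : functional R N m) D a f ka : linear_on D Q -> D f ->
  alternating ka ->
  Q (fun x v => a * (f x * ka v)) = a * Q (fun x v => f x * ka v).
Proof.
move=> Ql Df ak; have := Ql _ [:: tt] (fun=> a) _ _ (fun=> Df) (fun=> ak).
rewrite big_seq1 => <-; congr Q; apply/funext => x; apply/funext => v.
by rewrite big_seq1.
Qed.

Lemma linear_onB N m (Q : functional R N m) D f g ka : linear_on D Q ->
  D f -> D g -> alternating ka ->
  Q (fun x v => (f x - g x) * ka v) =
  Q (fun x v => f x * ka v) - Q (fun x v => g x * ka v).
Proof.
move=> Ql Df Dg ak.
have := Ql _ [:: true; false] (fun i : bool => if i then 1 else -1)
  (fun i : bool => if i then f else g) (fun=> ka).
rewrite !big_cons !big_nil addr0 mul1r mulN1r => <-; [|by case|by []].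
congr Q; apply/funext => x; apply/funext => v.
by rewrite !big_cons !big_nil addr0 mul1r mulN1r mulrBl.
Qed.

Lemma linear_on0 N m (Q : functional R N m) D : linear_on D Q -> D !=set0 ->
  Q (fun _ _ => 0) = 0.
Proof.
move=> Ql [f Df]; have := Ql _ (@nil unit) (fun=> 0) (fun=> f) (fun=> fun=> 0) (fun=> Df)
  (fun=> @alternating0 R m N).
rewrite big_nil => E; rewrite -[RHS]E; congr Q.
by apply/funext => x; apply/funext => v; rewrite big_nil.
Qed.

Lemma derive_scale N a (u x : 'rV[R]_N) : 'D_u (fun y : 'rV[R]_N => a *: y) x = a *: u.
Proof.
apply: cvg_lim => //; apply: cvg_near_cst; near=> h.
rewrite /= (scalerDr a) addrK !scalerA mulrAC mulVf ?mul1r//.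
near: h; exact: nbhs_dnbhs_neq.
Unshelve. all: by end_near. Qed.

Lemma dilateE N m a (T : functional R N m) w :
  dilate a T w = T (fun x v => w (a *: x) (a *: v)).
Proof.
congr T; apply/funext => x; apply/funext => v; rewrite /pullback; congr (w _ _).
by apply/row_matrixP => i; rewrite rowK derive_scale linearZ.
Qed.

Lemma alternating_scale N m a (ka : 'M[R]_(m, N) -> R) :
  alternating ka -> alternating (fun v => ka (a *: v)).
Proof.
apply: (@alternating_comp R m N m N ka (fun v => a *: v) id a%:M) => //.
  by move=> i A; rewrite mul_mx_scalar linearZ.
by move=> j A A'; rewrite codom_f.
Qed.

Definition cut N c (x : 'rV[R]_N) := plateau (c * nsq x).

Lemma smooth_cut N c : smooth (@cut N c).
Proof. exact: (smooth_plateau (smoothZ c (@smooth_nsq R N))). Qed.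

Lemma cut1 N c x : c * nsq x <= 1 -> @cut N c x = 1.
Proof. exact: plateau1. Qed.

Lemma cutZ N c a x : @cut N c (a *: x) = cut (c * a ^+ 2) x.
Proof. by rewrite /cut nsqZ mulrA. Qed.

Lemma cut_near N c (r : R) (x : 'rV[R]_N) :
  0 <= c -> c * (N%:R * r ^+ 2) <= 1 -> `|x| <= r -> cut c x = 1.
Proof.
move=> c0 cr xr; apply: cut1; apply: le_trans cr; rewrite ler_wpM2l//.
apply: le_trans (nsq_le x) _; rewrite ler_wpM2l// lerXn2r ?nnegrE//.
exact: le_trans xr.
Qed.

Lemma cut_far N c (r : R) (x : 'rV[R]_N) :
  0 <= c -> 0 <= r -> 2 <= c * r ^+ 2 -> r <= `|x| -> cut c x = 0.
Proof.
move=> c0 r0 cr rx; apply: plateau0; apply: le_trans cr _; rewrite ler_wpM2l//.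
by apply: le_trans (norm_le_nsq x); rewrite lerXn2r ?nnegrE.
Qed.

(** [nsq] lies between |x|^2 and N |x|^2: the lower bound gives the vanishing for e <= |x|, the
    upper bound the ball on which the value is 1. *)
Lemma cutoff_cut N (e : R) : 0 < e -> cutoff e (@cut N (2 / e ^+ 2)).
Proof.
move=> e0; have c0 : 0 < 2 / e ^+ 2 by rewrite divr_gt0 ?exprn_gt0.
split=> [x||x ex].
- by rewrite plateau_ge0 plateau_le1.
- have N0 : 0 < 2 * (N%:R + 1) :> R by rewrite mulr_gt0// ltr_wpDl.
  exists (e / (2 * (N%:R + 1))); first by rewrite divr_gt0.
  move=> x; apply: (cut_near (ltW c0)).
  have -> : 2 / e ^+ 2 * (N%:R * (e / (2 * (N%:R + 1))) ^+ 2) =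
    (N%:R / (2 * (N%:R + 1) ^+ 2) : R).
    by field; rewrite gt_eqF//= gt_eqF// ltr_wpDl.
  rewrite ler_pdivrMr ?mulr_gt0 ?exprn_gt0 ?ltr_wpDl// mul1r.
  by have : 0 <= N%:R :> R by []; nra.
- by apply: (cut_far (ltW c0) (ltW e0) _ ex); rewrite divfK// gt_eqF ?exprn_gt0.
Qed.

(** * Dilated cycles are tame *)

Section Dilate.
Variables (N m : nat) (T : functional R N m.+1) (la : R).
Hypotheses (Tc : is_current T) (T_cycle : cycle_current T)
  (T_nz : nonzero_current T) (la0 : 0 < la).

Lemma dilate_linear : linear_on (@smooth R N) (dilate la T).
Proof.
move=> I r c f ka sf ak; rewrite dilateE.
rewrite (current_linear Tc r c (fun i => smooth_dilation la (sf i))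
  (fun i => alternating_scale la (ak i))).
by apply: eq_bigr => i _; rewrite dilateE.
Qed.

Lemma dilate_const ka : alternating ka -> dilate la T (fun _ v => ka v) = 0.
Proof.
by move=> ak; rewrite dilateE (cycle_const Tc T_cycle (alternating_scale la ak)).
Qed.

(** T only sees coefficients on a ball of radius r. There a cutoff dilated by a small t is 1, which
    leaves a constant covector; and truncating a function outside that ball does not change its
    value under T. *)
Lemma tame_dilate : tame (dilate la T) (@smooth R N).
Proof.
have [r Tr] := current_local Tc.
have rr0 : 0 <= N%:R * r ^+ 2 by rewrite mulr_ge0 ?sqr_ge0.
split=> [//|f c sf|f l sf||e e0|].
- exact: smooth_dilation.
- exact: (smoothM (smooth_coord l) sf).
- exact: dilate_linear.
- pose c := 2 / e ^+ 2; have c0 : 0 < c by rewrite divr_gt0 ?exprn_gt0.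
  pose K := c * la ^+ 2 * (N%:R * r ^+ 2).
  have K0 : 0 <= K by rewrite mulr_ge0// mulr_ge0 ?sqr_ge0 ?ltW.
  have K1 : 0 < 1 + K by rewrite ltr_wpDr.
  (* For |x| <= r the argument of the plateau is at most K t^2 <= K t <= K / (1 + K) <= 1. *)
  exists (1 + K)^-1, (cut c); split.
  + by rewrite invr_gt0.
  + exact: smooth_cut.
  + exact: cutoff_cut.
  + move=> t ka /andP[t0 tK] ak; rewrite dilateE.
    have ak' := alternating_scale la ak.
    have s1 := smooth_dilation la (smooth_dilation t (@smooth_cut N c)).
    have E : T (fun x v => 1 * ka (la *: v)) = 0.
      rewrite -[RHS](cycle_const Tc T_cycle ak'); congr T.
      by apply/funext => x; apply/funext => v; rewrite mul1r.
    have := currentB Tc s1 (smooth_cst 1) ak'; rewrite E subr0 => <-.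
    apply: (Tr _ _ (smoothB s1 (smooth_cst 1)) ak') => x xr.
    apply/eqP; rewrite subr_eq0 !cutZ; apply/eqP.
    apply: (cut_near (r := r)) (ltW xr).
      exact: (mulr_ge0 (mulr_ge0 (ltW c0) (sqr_ge0 t)) (sqr_ge0 la)).
    have -> : c * t ^+ 2 * la ^+ 2 * (N%:R * r ^+ 2) = K * t ^+ 2 by rewrite /K; ring.
    have t1 : t <= 1 by rewrite (le_trans tK)// invf_le1// lerDl.
    have : t ^+ 2 <= (1 + K)^-1.
      by rewrite (le_trans _ tK)// expr2 ler_piMr.
    move=> /(ler_wpM2l K0) /le_trans; apply.
    by rewrite ler_pdivrMr// mul1r lerDr.
- have [s [f0 [sf0 Tf0]]] := current_nonzero_dx Tc T_nz.
  (* With this c the function [cut c] is 1 on |x| <= r. The later dilation by 1/la compensates that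
     of T. *)
  pose c := (N%:R * r ^+ 2 + 1)^-1; have c0 : 0 < c by rewrite invr_gt0 ltr_wpDl.
  pose h x := f0 x * cut c x.
  have sh : smooth h by exact: (smoothM sf0 (@smooth_cut N c)).
  pose f x := h (la^-1 *: x).
  have fla x : f (la *: x) = h x by rewrite /f scalerA mulVf ?gt_eqF// scale1r.
  have sf : smooth f by exact: (smooth_dilation la^-1 sh).
  have ads : alternating (@dx R _ _ s) by exact: dx_alternating.
  have EQ (t : R) : dilate la T (fun x v => f (t *: x) * dx s v) =
      T (fun x v => h (t *: x) * dx s (la *: v)).
    rewrite dilateE; congr T; apply/funext => x; apply/funext => v.
    by rewrite scalerA (mulrC t) -scalerA fla.
  exists f, s; split => //.
  + exists (la * (c^-1 + 2)) => x; rewrite mulrC -ltr_pdivlMr// => xr.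
    rewrite /f /h (@cut_far _ c (c^-1 + 2)) ?mulr0 ?(ltW c0)//.
    * by rewrite addr_ge0// invr_ge0 ltW.
    * rewrite -ler_pdivrMl//; have : 0 < c^-1 by rewrite invr_gt0.
      by set z := c^-1; nra.
    * by rewrite normrZ gtr0_norm ?invr_gt0// mulrC ltW.
  + under eq_fun do rewrite EQ.
    exact: (current_dilation_continuous Tc sh (alternating_scale la ads)).
  + rewrite (_ : (fun x v => f x * dx s v) = (fun x v => f (1 *: x) * dx s v));
    last first.
      by apply/funext => x; apply/funext => v; rewrite scale1r.
    rewrite EQ.
    have -> : T (fun x v => h (1 *: x) * dx s (la *: v)) = la ^+ m.+1 * T (fun x v =>
      h x * dx s v).
      rewrite -(currentZ Tc _ sh ads); congr T; apply/funext => x; apply/funext => v.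
      by rewrite dxZ scale1r mulrCA.
    rewrite mulf_neq0 ?expf_neq0 ?(gt_eqF la0)//.
    have D : T (fun x v => (h x - f0 x) * dx s v) = 0.
      apply: (Tr _ _ (smoothB sh sf0) ads) => x xr.
      rewrite /h (cut_near (ltW c0) _ (ltW xr)) ?mulr1 ?subrr//.
      by rewrite /c ler_pdivrMl ?ltr_wpDl// mulr1 lerDl.
    have /eqP := currentB Tc sh sf0 ads.
    by rewrite D eq_sym subr_eq0 => /eqP ->.
Qed.
End Dilate.

(** * Products of tame functionals *)

Section Cross.

Lemma norm_leP N (x : 'rV[R]_N) (e : R) : 0 <= e ->
  (`|x| <= e) = [forall i, `|x 0 i| <= e].
Proof.
move=> e0; apply/idP/forallP => [xe i|H]; first exact: le_trans (coord_le_norm x i) xe.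
rewrite /Num.norm/= mx_normrE; apply: bigmax_le => // -[i j] _ /=.
by rewrite ord1.
Qed.

Lemma norm_lsubmx N N' (z : 'rV[R]_(N + N')) : `|lsubmx z| <= `|z|.
Proof. by rewrite norm_leP//; apply/forallP => i; rewrite mxE coord_le_norm. Qed.

Lemma norm_rsubmx N N' (z : 'rV[R]_(N + N')) : `|rsubmx z| <= `|z|.
Proof. by rewrite norm_leP//; apply/forallP => i; rewrite mxE coord_le_norm. Qed.

Lemma norm_split_le N N' (z : 'rV[R]_(N + N')) (e : R) :
  `|lsubmx z| <= e -> `|rsubmx z| <= e -> `|z| <= e.
Proof.
move=> l r; have e0 : 0 <= e by exact: le_trans l.
move: l r; rewrite !norm_leP// => /forallP l /forallP r; apply/forallP => i.
case: (split_ordP i) => j ->; first by have := l j; rewrite mxE.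
by have := r j; rewrite mxE.
Qed.

Lemma norm_split_ge N N' (z : 'rV[R]_(N + N')) (e : R) :
  e <= `|z| -> e <= `|lsubmx z| \/ e <= `|rsubmx z|.
Proof.
move=> ez; have [|le] := leP e `|lsubmx z|; first by left.
have [|re] := leP e `|rsubmx z|; first by right.
have : `|z| <= Num.max `|lsubmx z| `|rsubmx z|.
  by apply: norm_split_le; rewrite le_max lexx ?orbT.
by move=> /(le_trans ez); rewrite le_max leNgt le /= leNgt re.
Qed.

Lemma cutoff_prod N N' (e : R) (g : 'rV[R]_N -> R) (h : 'rV[R]_N' -> R) :
  cutoff e g -> cutoff e h ->
  cutoff e (fun z : 'rV[R]_(N + N') => g (lsubmx z) * h (rsubmx z)).
Proof.
move=> [g01 [d1 d10 g1] g0] [h01 [d2 d20 h1] h0]; split=> [z||z].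
- have /andP[p1 p2] := g01 (lsubmx z); have /andP[q1 q2] := h01 (rsubmx z).
  by rewrite mulr_ge0//= mulr_ile1.
- exists (Num.min d1 d2) => [|z]; first by rewrite lt_min d10.
  rewrite le_min => /andP[zd1 zd2]; rewrite g1 ?h1 ?mulr1//.
    by rewrite (le_trans _ zd2)// norm_rsubmx.
  by rewrite (le_trans _ zd1)// norm_lsubmx.
- by move=> /norm_split_ge[/g0|/h0] ->; rewrite ?mul0r ?mulr0.
Qed.

Lemma cutoff_le N (e e' : R) (g : 'rV[R]_N -> R) : e <= e' -> cutoff e g -> cutoff e' g.
Proof. by move=> ee' [g01 g1 g0]; split=> // x /(le_trans ee')/g0. Qed.

Lemma smooth_lsubmx N N' (f : 'rV[R]_N -> R) :
  smooth f -> smooth (fun z : 'rV[R]_(N + N') => f (lsubmx z)).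
Proof.
apply: (@smooth_comp_linear R (N + N') N f (@lsubmx R 1 N N')).
  by move=> z; apply: differentiable_continuous; exact: differentiable_lsubmx.
by move=> h u x; rewrite linearP.
Qed.

Lemma smooth_rsubmx N N' (f : 'rV[R]_N' -> R) :
  smooth f -> smooth (fun z : 'rV[R]_(N + N') => f (rsubmx z)).
Proof.
apply: (@smooth_comp_linear R (N + N') N' f (@rsubmx R 1 N N')).
  by move=> z; apply: differentiable_continuous; exact: differentiable_rsubmx.
by move=> h u x; rewrite linearP.
Qed.

Lemma alternating_block_r N N' m m' (ka : 'M[R]_(m + m', N + N') -> R) u :
  alternating ka -> alternating (fun u' : 'M[R]_(m', N') => ka (block_mx u 0 0 u')).
Proof.
move=> ak; have := @alternating_comp R m' N' _ _ ka (fun u' : 'M[R]_(m', N') =>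
  block_mx u 0 0 u')
  (@rshift m m') (row_mx (0 : 'M[R]_(N', N)) 1%:M); apply => //.
- exact: rshift_inj.
- by move=> i A; rewrite /block_mx rowKd row_row_mx row0 mul_mx_row mulmx0 mulmx1.
- move=> j A A'; case: (split_ordP j) => k -> h; first by rewrite /block_mx !rowKu.
  by case/negP: h; exact: codom_f.
Qed.

Lemma alternating_block_l N N' m m' (ka : 'M[R]_(m + m', N + N') -> R) u' :
  alternating ka -> alternating (fun u : 'M[R]_(m, N) => ka (block_mx u 0 0 u')).
Proof.
move=> ak; have := @alternating_comp R m N _ _ ka (fun u : 'M[R]_(m, N) =>
  block_mx u 0 0 u')
  (@lshift m m') (row_mx 1%:M (0 : 'M[R]_(N, N'))); apply => //.
- exact: lshift_inj.
- by move=> i A; rewrite /block_mx rowKu row_row_mx row0 mul_mx_row mulmx0 mulmx1.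
- move=> j A A'; case: (split_ordP j) => k -> h; last by rewrite /block_mx !rowKd.
  by case/negP: h; exact: codom_f.
Qed.

Section Product.
Variables (N N' m m' : nat) (P : functional R N m) (Q : functional R N' m').
Variables (DP : set ('rV[R]_N -> R)) (DQ : set ('rV[R]_N' -> R)).

(** Q applied in the second block only. On a product function the outer functional then meets its
    own coefficient times this constant covector, so no regularity of an inner value has to be
    shown. *)
Definition contract (h : 'rV[R]_N' -> R) (ka : 'M[R]_(m + m', N + N') -> R) u :=
  Q (fun y u' => h y * ka (block_mx u 0 0 u')).

Lemma linear_on_comb h k1 k2 b c : linear_on DQ Q -> DQ h ->
  alternating k1 -> alternating k2 ->
  Q (fun y u => h y * (b * k1 u + c * k2 u)) =
  b * Q (fun y u => h y * k1 u) + c * Q (fun y u => h y * k2 u).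
Proof.
move=> Ql Dh a1 a2; have := Ql _ [:: true; false] (fun x : bool => if x then b else c)
  (fun=> h) (fun x : bool => if x then k1 else k2) (fun=> Dh).
rewrite !big_cons !big_nil addr0 => <-; last by case.
congr Q; apply/funext => y; apply/funext => u.
by rewrite !big_cons !big_nil addr0; ring.
Qed.

Lemma contract_alternating h ka : linear_on DQ Q -> DQ h -> alternating ka ->
  alternating (contract h ka).
Proof.
move=> Ql Dh ak; have akr u := alternating_block_r u ak.
split=> [A B C i b c r1 r2 r3|A i j ij r].
  rewrite /contract -(linear_on_comb _ _ Ql Dh (akr B) (akr C)); congr Q.
  apply/funext => y; apply/funext => u'; congr (_ * _).
  by have [k1 _] := alternating_block_l u' ak; exact: (k1 _ _ _ _ _ _ r1 r2 r3).
have Q0 := linear_on0 Ql (ex_intro _ h Dh).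
rewrite /contract -[RHS]Q0; congr Q; apply/funext => y; apply/funext => u'.
have [_ k2] := alternating_block_l u' ak.
by rewrite (k2 _ _ _ ij r) mulr0.
Qed.

Lemma cross_prod f h ka : linear_on DQ Q -> DQ h -> alternating ka ->
  cross P Q (fun z v => f (lsubmx z) * h (rsubmx z) * ka v) =
  P (fun x u => f x * contract h ka u).
Proof.
move=> Ql Dh ak; congr P; apply/funext => x; apply/funext => u.
rewrite -(linear_onZ _ Ql Dh (alternating_block_r u ak)); congr Q.
by apply/funext => y; apply/funext => u'; rewrite row_mxKl row_mxKr mulrA.
Qed.

Lemma cross_sum I (r : seq I) (c : I -> R) (f : I -> 'rV[R]_N -> R)
    (h : I -> 'rV[R]_N' -> R) (ka : I -> 'M[R]_(m + m', N + N') -> R) :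
  linear_on DP P -> linear_on DQ Q -> (forall i, DP (f i)) -> (forall i, DQ (h i)) ->
  (forall i, alternating (ka i)) ->
  cross P Q (fun z v => \sum_(i <- r) c i * (f i (lsubmx z) * h i (rsubmx z) * ka i v)) =
  \sum_(i <- r) c i * P (fun x u => f i x * contract (h i) (ka i) u).
Proof.
move=> Pl Ql Df Dh ak.
rewrite -(Pl _ r c f _ Df (fun i => contract_alternating Ql (Dh i) (ak i))).
congr P; apply/funext => x; apply/funext => u.
have := Ql _ r (fun i => c i * f i x) h _ Dh (fun i => alternating_block_r u (ak i)).
under [X in _ = X -> _]eq_bigr do rewrite -mulrA.
move=> <-; congr Q; apply/funext => y; apply/funext => u'.
by apply: eq_bigr => i _; rewrite row_mxKl row_mxKr !mulrA.
Qed.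

Lemma contract_dx h s s' u : linear_on DQ Q -> DQ h ->
  contract h (@dx R _ _ (fcat s s')) u = dx s u * Q (fun y u' => h y * dx s' u').
Proof.
move=> Ql Dh; rewrite -(linear_onZ _ Ql Dh (dx_alternating s')); congr Q.
by apply/funext => y; apply/funext => u'; rewrite dx_block mulrCA.
Qed.

Definition prod_fun : set ('rV[R]_(N + N') -> R) :=
  [set f | exists f1 f2, [/\ DP f1, DQ f2 &
     f = fun z => f1 (lsubmx z) * f2 (rsubmx z)]].

(** On product functions everything reduces to the two factors; on [dx (fcat s1 s2)] the value is
    the product of the two values, which gives continuity in t and nonvanishing. *)
Lemma tame_cross : tame P DP -> tame Q DQ -> tame (cross P Q) prod_fun.
Proof.
move=> tP tQ; have Pl := tame_linear tP; have Ql := tame_linear tQ.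
split.
- move=> _ [f1 [f2 [D1 D2 ->]]].
  have s1 : smooth (fun z : 'rV[R]_(N + N') => f1 (lsubmx z)).
    exact: (smooth_lsubmx (tame_smooth tP D1)).
  have s2 : smooth (fun z : 'rV[R]_(N + N') => f2 (rsubmx z)).
    exact: (smooth_rsubmx (tame_smooth tQ D2)).
  exact: (smoothM s1 s2).
- move=> _ c [f1 [f2 [D1 D2 ->]]].
  exists (fun x => f1 (c *: x)), (fun x => f2 (c *: x)); split.
  + exact: tame_dilation tP _ _ D1.
  + exact: tame_dilation tQ _ _ D2.
  + by apply/funext => z; rewrite !linearZ.
- move=> _ l [f1 [f2 [D1 D2 ->]]]; case: (split_ordP l) => j ->.
    exists (fun x : 'rV[R]_N => x 0 j * f1 x), f2; split=> //;
      first exact: tame_coord tP _ _ D1.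
    by apply/funext => z; rewrite mxE mulrA.
  exists f1, (fun x : 'rV[R]_N' => x 0 j * f2 x); split=> //;
    first exact: tame_coord tQ _ _ D2.
  by apply/funext => z; rewrite mxE mulrCA.
- move=> I r c f ka Df ak.
  have /choice[f1 H1] := Df; have /choice[f2 H2] := H1.
  have D1 i : DP (f1 i) by have [] := H2 i.
  have D2 i : DQ (f2 i) by have [] := H2 i.
  have Ef i : f i = fun z => f1 i (lsubmx z) * f2 i (rsubmx z) by have [] := H2 i.
  rewrite (_ : f = fun i z => f1 i (lsubmx z) * f2 i (rsubmx z)); last exact/funext.
  rewrite (cross_sum _ _ Pl Ql D1 D2 ak).
  by apply: eq_bigr => i _; rewrite (cross_prod _ Ql (D2 i) (ak i)).
(* The threshold of Q alone suffices: for t <= t0 the inner application is already 0, whatever the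
   first cutoff does. *)
- move=> e e0; have [_ [g1 [_ D1 cut1 _]]] := tame_cutoff tP e0.
  have [t0 [g2 [t00 D2 cut2 Q0]]] := tame_cutoff tQ e0.
  exists t0, (fun z => g1 (lsubmx z) * g2 (rsubmx z)); split => //.
  + by exists g1, g2.
  + exact: cutoff_prod.
  + move=> t ka tt ak; have Dd := tame_dilation tQ t D2.
    have -> : (fun (z : 'rV[R]_(N + N')) v =>
      g1 (lsubmx (t *: z)) * g2 (rsubmx (t *: z)) * ka v) =
       (fun z v => g1 (t *: lsubmx z) * g2 (t *: rsubmx z) * ka v).
      by apply/funext => z; apply/funext => v; rewrite !linearZ.
    rewrite (cross_prod (fun x => g1 (t *: x)) Ql Dd ak).
    rewrite -[RHS](linear_on0 Pl (ex_intro _ g1 D1)); congr P.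
    apply/funext => x; apply/funext => u.
    by rewrite /contract Q0 ?mulr0//; exact: alternating_block_r.
- have [f1 [s1 [D1 [r1 K1] c1 n1]]] := tame_nonzero tP.
  have [f2 [s2 [D2 [r2 K2] c2 n2]]] := tame_nonzero tQ.
  have E (t : R) : cross P Q (fun z v =>
    f1 (lsubmx (t *: z)) * f2 (rsubmx (t *: z)) * dx (fcat s1 s2) v)
    = P (fun x u => f1 (t *: x) * dx s1 u) * Q (fun y u' => f2 (t *: y) * dx s2 u').
    have -> : (fun (z : 'rV[R]_(N + N')) v =>
      f1 (lsubmx (t *: z)) * f2 (rsubmx (t *: z)) * dx (fcat s1 s2) v) =
       (fun z v => f1 (t *: lsubmx z) * f2 (t *: rsubmx z) * dx (fcat s1 s2) v).
      by apply/funext => z; apply/funext => v; rewrite !linearZ.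
    have Dd := tame_dilation tQ t D2.
    rewrite (cross_prod (fun x => f1 (t *: x)) Ql Dd (dx_alternating _)).
    rewrite mulrC -(linear_onZ _ Pl (tame_dilation tP t D1) (dx_alternating s1)).
    congr P; apply/funext => x; apply/funext => u.
    by rewrite (contract_dx _ _ _ Ql Dd); ring.
  exists (fun z => f1 (lsubmx z) * f2 (rsubmx z)), (fcat s1 s2); split.
  + by exists f1, f2.
  + exists (Num.max r1 r2) => z zr.
    have [le|le] := ltP r1 `|lsubmx z|; first by rewrite K1// mul0r.
    have [re|re] := ltP r2 `|rsubmx z|; first by rewrite K2// mulr0.
    have : `|z| <= Num.max r1 r2 by apply: norm_split_le; rewrite le_max ?le ?re ?orbT.
    by rewrite leNgt zr.
  + under eq_fun do rewrite E.
    by move=> t; apply: cvgM; [exact: c1|exact: c2].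
  + have := E 1.
    have -> : (fun (z : 'rV[R]_(N + N')) v =>
      f1 (lsubmx (1 *: z)) * f2 (rsubmx (1 *: z)) * dx (fcat s1 s2) v) =
       (fun z v => f1 (lsubmx z) * f2 (rsubmx z) * dx (fcat s1 s2) v).
      by apply/funext => z; apply/funext => v; rewrite !scale1r.
    move=> ->; rewrite mulf_neq0//.
    * rewrite (_ : (fun x u => _) = (fun x u => f1 x * dx s1 u))//.
      by apply/funext => x; apply/funext => u; rewrite scale1r.
    * rewrite (_ : (fun x u => _) = (fun x u => f2 x * dx s2 u))//.
      by apply/funext => x; apply/funext => u; rewrite scale1r.
Qed.
End Product.

Lemma tame_cross_family n (d k : 'I_n.+1 -> nat)
    (T : forall i, functional R (d i) (k i)) :
  (forall i, exists D, tame (T i) D) -> exists D, tame (cross_family T) D.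
Proof.
elim: n d k T => [|n IH] d k T tT; first exact: tT ord0.
have [D0 t0] := tT ord0.
have [D1 t1] := IH _ _ (fun i => T (lift ord0 i)) (fun i => tT (lift ord0 i)).
by exists (prod_fun D0 D1); exact: tame_cross.
Qed.

End Cross.
End Tame.

(** * Cones *)

Section SphereCycle.
Variable R : realType.
Implicit Types N m : nat.

(** What remains of a cycle of finite mass on the sphere of radius [la]: coefficients matter only
    through their values on the sphere, and [sphere_radial], which annihilates (x . dx) /\ dx_s,
    expresses tangency to the sphere. *)
Record sphere_cycle N m (la : R) (P : functional R N m.+1) : Prop := SphereCycle {
  sphere_tame : tame P (@smooth R N);
  sphere_const : forall ka, alternating ka -> P (fun _ v => ka v) = 0;
  sphere_vanish : forall h ka, smooth h -> alternating ka ->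
    (forall x, nsq x = la ^+ 2 -> h x = 0) -> P (fun x v => h x * ka v) = 0;
  sphere_radial : forall c (s : 'I_m -> 'I_N), smooth c ->
    \sum_l P (fun x v => c x * x 0 l * dx (fcons l s) v) = 0 }.

Lemma sphere_cycle_dilate N m (T : functional R N.+1 m.+1) la :
  is_current T -> (mass T < +oo)%E -> supported_in T (@unit_sphere R N) ->
  cycle_current T -> nonzero_current T -> 0 < la -> sphere_cycle la (dilate la T).
Proof.
move=> Tc Tm Ts Ty Tn la0; split.
- exact: tame_dilate.
- by move=> ka ak; apply: (dilate_const la Tc Ty ak).
- move=> h ka sh ak h0; rewrite dilateE.
  apply: (finite_mass_sphere Tc Tm Ts (smooth_dilation la sh) (alternating_scale la ak)).
  move=> x xS; apply: h0; rewrite nsqZ (_ : nsq x = 1) ?mulr1//.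
- move=> c s sc; have := cycle_radial Tc Tm Ts Ty s (smooth_dilation la sc).
  (* The factor la comes from the dilated coordinate and la^(m+1) from dx on dilated vectors. *)
  move=> /(congr1 ( *%R (la * la ^+ m.+1))); rewrite mulr0 => E; rewrite -[RHS]E.
  rewrite mulr_sumr; apply: eq_bigr => l _; rewrite dilateE.
  have s1 : smooth (fun x : 'rV[R]_N.+1 => c (la *: x) * x 0 l).
    exact: (smoothM (smooth_dilation la sc) (smooth_coord l)).
  rewrite -(currentZ Tc _ s1 (dx_alternating _)); congr T.
  by apply/funext => x; apply/funext => v; rewrite dxZ !mxE; ring.
Qed.

Lemma sphere_eq N m la (P : functional R N m.+1) f h ka : sphere_cycle la P ->
  smooth f -> smooth h -> alternating ka -> (forall x, nsq x = la ^+ 2 -> f x = h x) ->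
  P (fun x v => f x * ka v) = P (fun x v => h x * ka v).
Proof.
move=> sP sf sh ak fh; apply/eqP; rewrite -subr_eq0.
rewrite -(linear_onB (tame_linear (sphere_tame sP)) sf sh ak); apply/eqP.
by apply: (sphere_vanish sP (smoothB sf sh) ak) => x /fh ->; rewrite subrr.
Qed.

Lemma sphere_cst N m la (P : functional R N m.+1) h k ka : sphere_cycle la P ->
  smooth h -> alternating ka ->
  (forall x, nsq x = la ^+ 2 -> h x = k) -> P (fun x v => h x * ka v) = 0.
Proof.
move=> sP sh ak hk; rewrite (sphere_eq sP sh (smooth_cst k) ak hk).
exact: (sphere_const sP (alternatingZ k ak)).
Qed.

End SphereCycle.

(** * An explicit formula for the cone, and its vanishing on g phi_0 *)

Section Cone.
Variable R : realType.

(** The map is quadratic: its difference quotient is exactly d plus h times a constant vector. *)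
Lemma derive_cone N (z r : 'rV[R]_(1 + N)) :
  'D_r (fun z : 'rV[R]_(1 + N) => lsubmx z 0 0 *: rsubmx z) z =
  lsubmx r 0 0 *: rsubmx z + lsubmx z 0 0 *: rsubmx r.
Proof.
set d := _ + _; apply: cvg_lim => //.
have cc : (d + h *: (lsubmx r 0 0 *: rsubmx r)) @[h --> (0 : R)] --> d.
  rewrite -[X in _ --> X]addr0 -(scale0r (lsubmx r 0 0 *: rsubmx r)).
  have sc : continuous (fun h : R => h *: (lsubmx r 0 0 *: rsubmx r)).
    exact: scalel_continuous.
  by apply: cvgD; [exact: cvg_cst|exact: sc].
have {}cc : (d + h *: (lsubmx r 0 0 *: rsubmx r)) @[h --> (0 : R)^'] --> d.
  by move=> A /cc; apply: nbhs_dnbhs.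
apply: cvg_trans cc.
apply: near_eq_cvg; near=> h.
have h0 : h != 0 by near: h; exact: nbhs_dnbhs_neq.
rewrite /= !linearD !linearZ /= !mxE /d; apply/rowP => i; rewrite !mxE.
by field.
Unshelve. all: by end_near. Qed.

(** The differential of (t, x) -> t x sends the unit vector of the half-line to x and a vector u of
    the other factor to t u: the integrand contains the interior product with the position
    vector. *)
Lemma coneE N m (T : functional R N m) (w : dform R N m.+1) :
  cone T w = \int[@lebesgue_measure R]_(t in `[0, +oo[)
    T (fun x u => w (t *: x) (col_mx x (t *: u) : 'M[R]_(1 + m, N))).
Proof.
congr (Rintegral _ _ _); apply/funext => t; congr T.
apply/funext => y; apply/funext => u; rewrite /pullback; congr (w _ _).
  by rewrite row_mxKl row_mxKr mxE.
apply/row_matrixP => i; rewrite rowK derive_cone row_mxKl row_mxKr.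
have -> : (t%:M : 'M[R]_1) 0 0 = t by rewrite mxE.
have H (j : 'I_(1 + m)) : lsubmx (row j (block_mx (1%:M : 'M[R]_1) 0 0 u)) 0 0 *: y +
    t *: rsubmx (row j (block_mx (1%:M : 'M[R]_1) 0 0 u)) = row j (col_mx y (t *: u)).
  case: (split_ordP j) => k ->.
    rewrite rowKu /block_mx rowKu row_row_mx row_mxKl row_mxKr row0 scaler0 addr0.
    rewrite ord1 !row_id (_ : 1%:M 0 0 = 1) ?scale1r//.
    by rewrite mxE.
  rewrite rowKd /block_mx rowKd row_row_mx row_mxKl row_mxKr row0 mxE scale0r add0r.
  by rewrite linearZ.
exact: H.
Qed.

Section Pair.
Variables (a b p q : nat) (la : R) (P : functional R a p.+1) (Q : functional R b q).
Variable DQ : set ('rV[R]_b -> R).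
Hypotheses (la0 : 0 < la) (sP : sphere_cycle la P) (tQ : tame Q DQ).

Lemma alternating_col_mx N m t (x : 'rV[R]_N) (ka : 'M[R]_(1 + m, N) -> R) :
  alternating ka -> alternating (fun v : 'M[R]_(m, N) => ka (col_mx x (t *: v))).
Proof.
move=> ak; have := @alternating_comp R m N _ _ ka (fun v : 'M[R]_(m, N) =>
  col_mx x (t *: v))
  (@rshift 1 m) t%:M; apply => //.
- exact: rshift_inj.
- by move=> i A; rewrite rowKd mul_mx_scalar linearZ.
- move=> j A A'; case: (split_ordP j) => k -> h; first by rewrite !rowKu.
  by case/negP: h; exact: codom_f.
Qed.

(* The integrand vanishes for each [t]: for [t <= t0] the form splits into terms to which
   the cycle property of P or of Q applies, and for [t > t0] the cutoff of the first
   variable vanishes on the support of P. *)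
Lemma cone_cutoff (phi : 'M[R]_(1 + (p.+1 + q), a + b) -> R) (e : R) :
  alternating phi -> 0 < e ->
  exists g, [/\ smooth g, cutoff e g &
    cone (cross P Q) (fun z v => g z * phi v) = 0].
Proof.
move=> aphi e0; have tP := sphere_tame sP.
have Pl := tame_linear tP; have Ql := tame_linear tQ.
have [t0 [g1 [t00 D1 c1 Q0]]] := tame_cutoff tQ e0.
(* The bound e' <= t0 la makes g0 (t x) vanish for |x| = la (Euclidean) as soon as t > t0. *)
pose e' := Num.min e (t0 * la).
have e'0 : 0 < e' by rewrite lt_min e0 mulr_gt0.
pose g0 := @cut R a (2 / e' ^+ 2).
have cut0 : cutoff e' g0 by exact: cutoff_cut.
have sg0 : smooth g0 by exact: smooth_cut.
exists (fun z => g0 (lsubmx z) * g1 (rsubmx z)); split.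
- have s1 : smooth (fun z : 'rV[R]_(a + b) => g0 (lsubmx z)).
    exact: (smooth_lsubmx sg0).
  have s2 : smooth (fun z : 'rV[R]_(a + b) => g1 (rsubmx z)).
    exact: (smooth_rsubmx (tame_smooth tQ D1)).
  exact: (smoothM s1 s2).
- by apply: cutoff_prod => //; apply: cutoff_le cut0; rewrite ge_min lexx.
have H t : 0 <= t -> cross P Q (fun x u => g0 (lsubmx (t *: x)) * g1 (rsubmx (t *: x)) *
    phi (col_mx x (t *: u))) = 0.
  move=> t_ge0.
  (* The position vector is expanded in the standard basis: [psi l] is the constant covector
     belonging to x_l, and [f l], [h l] distribute x_l and the cutoffs over the two factors. *)
  pose psi l v := phi (col_mx (delta_mx 0 l) (t *: v)).
  have apsi l : alternating (psi l) by exact: alternating_col_mx.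
  pose f (l : 'I_(a + b)) : 'rV[R]_a -> R := match fintype.split l with
    | inl j => fun x => x 0 j * g0 (t *: x) | inr j => fun x => g0 (t *: x) end.
  pose h (l : 'I_(a + b)) : 'rV[R]_b -> R := match fintype.split l with
    | inl j => fun y => g1 (t *: y) | inr j => fun y => y 0 j * g1 (t *: y) end.
  have st := smooth_dilation t sg0.
  have sf l : smooth (f l).
    by rewrite /f; case: (fintype.split l) => j;
      [exact: (smoothM (smooth_coord j) st)|exact: st].
  have Dt := tame_dilation tQ t D1.
  have Dh l : DQ (h l).
    by rewrite /h; case: (fintype.split l) => j; [exact: Dt|exact: (tame_coord tQ j Dt)].
  have -> : (fun x u => g0 (lsubmx (t *: x)) * g1 (rsubmx (t *: x)) * phi (col_mx x (t
    *: u))) =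
     (fun z v => \sum_l 1 * (f l (lsubmx z) * h l (rsubmx z) * psi l v)).
    apply/funext => z; apply/funext => v.
    have /alternatingP[mphi _] := aphi.
    rewrite {3}(row_sum_delta z) multilinear_col_mx_sum// mulr_sumr !linearZ /=.
    apply: eq_bigr => l _; rewrite mul1r /f /h /psi.
    by case: (split_ordP l) => j ->;
      rewrite ?(unsplitK (inl _)) ?(unsplitK (inr _)) !mxE; ring.
  rewrite (cross_sum _ _ Pl Ql sf Dh apsi) big1// => l _; rewrite mul1r.
  have aC := contract_alternating Ql (Dh l) (apsi l).
  (* If x_l is a coordinate of the second factor, the coefficient for P is g0 (t x), constant on the
     sphere; otherwise the coefficient for Q is the bare cutoff g1 (t y). *)
  move: aC (sf l); rewrite /f /h; case: (fintype.split l) => j aC sfl; last first.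
    apply: (sphere_cst (k := plateau (2 / e' ^+ 2 * (t ^+ 2 * la ^+ 2))) sP st aC).
    by move=> x xS; rewrite /g0 /cut nsqZ xS.
  have [tt0|tt0] := leP t t0.
    rewrite -[RHS](linear_on0 Pl (ex_intro _ _ sg0)); congr P.
    apply/funext => x; apply/funext => u; rewrite /contract Q0 ?mulr0 ?t_ge0//.
    exact: alternating_block_r.
  apply: (sphere_vanish sP sfl aC) => x xS; rewrite /g0 /cut nsqZ xS plateau0 ?mulr0//.
  rewrite mulrAC ler_pdivlMr ?exprn_gt0// ler_wpM2l// -exprMn.
  rewrite lerXn2r ?nnegrE ?(ltW e'0) ?mulr_ge0 ?(ltW la0)//.
  by rewrite ge_min ler_wpM2r ?orbT ?(ltW la0)// ltW.
rewrite coneE /Rintegral; under eq_integral => t.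
  rewrite inE /= in_itv /= andbT => t_ge0; rewrite H//; over.
by rewrite integral0.
Qed.
End Pair.
End Cone.

(** * Test forms near the origin on which the cone does not vanish *)

Section ConeNonzero.
Variable R : realType.

Lemma Rintegral_halfline_gt0 (f : R -> R) (t0 B : R) : continuous f ->
  (forall t, 0 <= t -> 0 <= f t) -> (forall t, B <= t -> f t = 0) ->
  0 < t0 -> 0 < f t0 -> 0 < \int[@lebesgue_measure R]_(t in `[0, +oo[) f t.
Proof.
move=> fc f0 fB t00 ft0.
have fm (D : set (measurableTypeR R)) : measurable D ->
    measurable_fun D (fun t : measurableTypeR R => (f t)%:E).
  move=> mD; apply/measurable_EFinP; apply: measurable_funTS.
  exact: continuous_measurable_fun.
have tB : t0 < B by rewrite ltNge; apply/negP => /fB E; move: ft0; rewrite E ltxx.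
have [d /= d0 Hd] : exists2 d : R, 0 < d & forall t, `|t - t0| < d -> f t0 / 2 < f t.
  have H : \forall t \near t0, f t0 / 2 < f t.
    have ct : f t @[t --> t0] --> f t0 by exact: fc.
    by apply: (cvgr_gt _ ct); lra.
  have /nbhs_normP[d /= d0 Hd] := H.
  by exists d => // t td; apply: Hd; rewrite /ball_/= distrC.
set mu := @lebesgue_measure R.
pose I0 := `[0, +oo[%classic : set R; pose IB := `[0, B]%classic : set R.
have E : (\int[mu]_(t in I0) (f t)%:E = \int[mu]_(t in IB) (f t)%:E)%E.
  rewrite integral_mkcond [RHS]integral_mkcond; apply: eq_integral => t _.
  have m0 : (t \in I0) = (0 <= t) by rewrite /I0 mem_setE in_itv /= andbT.
  have mB : (t \in IB) = (0 <= t <= B) by rewrite /IB mem_setE in_itv.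
  rewrite /patch m0 mB; case: (leP 0 t) => //= t_ge0.
  by case: (leP t B) => // /ltW/fB ->.
rewrite /Rintegral -/mu -/I0 E.
have mIB : measurable (IB : set (measurableTypeR R)) by exact: measurable_itv.
have int : mu.-integrable IB (fun t => (f t)%:E).
  by apply: continuous_compact_integrable;
    [exact: segment_compact|exact: continuous_subspaceT].
(* Since [fine] sends +oo to 0, positivity also requires that the integral is finite, which holds on
   the compact interval [0, B]. *)
apply: fine_gt0; apply/andP; split; last first.
  have := integrable_fin_num mIB int.
  by rewrite fin_numE => /andP[_]; rewrite ltey.
pose d' := Num.min (d / 2) (B - t0).
pose Id := `[t0, t0 + d']%classic : set R.
have mId : measurable (Id : set (measurableTypeR R)) by exact: measurable_itv.
have d'0 : 0 < d' by rewrite lt_min divr_gt0//= subr_gt0.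
apply: (@lt_le_trans _ _ (\int[mu]_(t in Id) ((f t0 / 2)%R)%:E)%E).
  rewrite integral_cst//= /mu /Id lebesgue_measure_itv /= lte_fin ltrDl d'0 -EFinD
    -EFinM lte_fin.
  by rewrite addrC addKr mulr_gt0 ?divr_gt0.
apply: (@le_trans _ _ (\int[mu]_(t in Id) (f t)%:E)%E).
  apply: ge0_le_integral => //=.
  - by move=> t _; rewrite lee_fin divr_ge0 ?ltW.
  - exact: fm.
  - move=> t; rewrite /Id /= in_itv /= => /andP[t1 t2]; rewrite lee_fin ltW// Hd//.
    rewrite ger0_norm ?subr_ge0// ltrBlDl; apply: le_lt_trans t2 _.
    by rewrite ltrD2l /d' gt_min; apply/orP; left; rewrite ltr_pdivrMr// ltr_pMr// ltr1n.
apply: ge0_subset_integral => //=.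
- exact: fm.
- by move=> t; rewrite /IB /= in_itv /= => /andP[h _]; rewrite lee_fin f0.
- move=> t; rewrite /Id /IB /= !in_itv /= => /andP[t1 t2].
  rewrite (le_trans (ltW t00) t1)/= (le_trans t2)// -lerBrDl.
  by rewrite /d' ge_min lexx orbT.
Qed.

Lemma continuous_plateau : continuous (@plateau R).
Proof.
have c1 : continuous (fun x : R => flat 1 (2 - x)).
  move=> x; apply: (@continuous_comp _ _ _ (fun x : R => 2 - x));
    last exact: continuous_flat.
  by apply: cvgB; [exact: cvg_cst|exact: cvg_id].
have c2 : continuous (fun x : R => flat 1 (x - 1)).
  move=> x; apply: (@continuous_comp _ _ _ (fun x : R => x - 1));
    last exact: continuous_flat.
  by apply: cvgB; [exact: cvg_id|exact: cvg_cst].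
move=> x; apply: cvgM; first exact: c1.
by apply: cvgV; [rewrite gt_eqF// plateau_den_gt0|apply: cvgD; [exact: c1|exact: c2]].
Qed.

(** With the extra index in the first factor the matrix is block upper triangular, and y occurs only
    off the diagonal: the form sees only the x-part of the position vector. *)
Lemma dx_cone_block a b m q (s : 'I_(1 + m) -> 'I_a) (s' : 'I_q -> 'I_b)
    (x : 'rV[R]_a) (y : 'rV[R]_b) (u : 'M[R]_(m, a)) (u' : 'M[R]_(q, b)) :
  dx (fcat s s') (col_mx (row_mx x y) (block_mx u 0 0 u') : 'M[R]_(1 + (m + q), a + b)) =
  dx s (col_mx x u) * dx s' u'.
Proof.
rewrite /dx -(det_ublock _ (col_mx (colsub s' y) 0)); congr (\det _).
apply/matrixP => i j; rewrite [LHS]mxE /fcat.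
have E0 : lshift q (lshift m (ord0 : 'I_1)) = lshift (m + q) (ord0 :
  'I_1) :> 'I_(1 + (m + q)) by exact/val_inj.
have E1 i1 : lshift q (rshift 1 i1) =
  rshift 1 (lshift q i1) :> 'I_(1 + (m + q)) by exact/val_inj.
have E2 i1 : rshift (1 + m) i1 =
  rshift 1 (rshift m i1) :> 'I_(1 + (m + q)) by exact/val_inj.
case: (split_ordP i) => i' ->; case: (split_ordP j) => j' ->;
  rewrite ?(unsplitK (inl _)) ?(unsplitK (inr _)) ?block_mxEul ?block_mxEur
    ?block_mxEdl ?block_mxEdr.
- case: (split_ordP i') => k ->.
    by rewrite ord1 E0 [LHS]col_mxEu row_mxEl [RHS]mxE col_mxEu.
  by rewrite E1 [LHS]col_mxEd block_mxEul [RHS]mxE col_mxEd.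
- case: (split_ordP i') => k ->.
    by rewrite ord1 E0 [LHS]col_mxEu row_mxEr [RHS]col_mxEu mxE.
  by rewrite E1 [LHS]col_mxEd block_mxEur [RHS]col_mxEd !mxE.
- by rewrite E2 [LHS]col_mxEd block_mxEdl !mxE.
- by rewrite E2 [LHS]col_mxEd block_mxEdr !mxE.
Qed.

Lemma fcons_lift2 m T (l : T) (s : 'I_m.+1 -> T) (i : 'I_m.+1) :
  (fun j => fcons l s (lift (lift ord0 i) j)) = fcons l (fun j => s (lift i j)).
Proof.
apply/funext => j; case: (unliftP ord0 j) => [k|] ->.
  rewrite fconsS (_ : lift _ _ = lift ord0 (lift i k)) ?fconsS//.
  by apply/val_inj; rewrite /= /bump /=; lia.
rewrite fcons0 (_ : lift _ _ = ord0) ?fcons0//.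
by apply/val_inj; rewrite /= /bump.
Qed.

Section Sphere.
Variables (a p : nat) (la : R) (P : functional R a p.+1).
Hypothesis sP : sphere_cycle la P.

(* By [sphere_radial] only the part [|x|^2 dx_s] of the interior product of [x] with
   [d(|x|^2) /\ dx_s / 2] survives. *)
Lemma sphere_radial_cone c (s : 'I_p.+1 -> 'I_a) t : smooth c ->
  P (fun x u => \sum_l c x * x 0 l * dx (fcons l s) (col_mx x (t *: u) :
    'M[R]_(1 + p.+1, a))) =
  t ^+ p.+1 * P (fun x u => c x * nsq x * dx s u).
Proof.
move=> sc; have Pl := tame_linear (sphere_tame sP).
pose F (k : 'I_a * 'I_p.+2) (x : 'rV[R]_a) := c x * x 0 k.1 * x 0 (fcons k.1 s k.2).
pose K (k : 'I_a * 'I_p.+2) := @dx R p.+1 a (fun j => fcons k.1 s (lift k.2 j)).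
have sF k : smooth (F k).
  exact: (smoothM (smoothM sc (smooth_coord _)) (smooth_coord _)).
have aK k : alternating (K k) by exact: dx_alternating.
have -> : (fun x u => \sum_l c x * x 0 l * dx (fcons l s) (col_mx x (t *: u) :
  'M[R]_(1 + p.+1, a))) =
    (fun x u => \sum_(k : 'I_a * 'I_p.+2) t ^+ p.+1 * (-1) ^+ k.2 * (F k x * K k u)).
  apply/funext => x; apply/funext => u.
  under eq_bigr => l _ do rewrite dx_col_mx mulr_sumr.
  rewrite pair_bigA /=; apply: eq_bigr => k _; rewrite dxZ /F /K; ring.
rewrite (Pl _ _ _ _ _ sF aK) -(pair_bigA _ (fun (l : 'I_a) (i : 'I_p.+2) =>
  t ^+ p.+1 * (-1) ^+ i * P (fun x u => F (l, i) x * K (l, i) u))) /=.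
(* Index 0 of the expansion removes dx_l and yields x_l^2. Index i + 1 removes dx_{s i} and keeps
   dx_l, which leaves the radial form with coefficient c x_{s i}. *)
rewrite exchange_big big_ord_recl /= [X in _ + X]big1 ?addr0 => [|i _]; last first.
  rewrite -mulr_sumr; apply/eqP; rewrite mulf_eq0; apply/orP; right; apply/eqP.
  rewrite -[RHS](sphere_radial sP (fun j =>
    s (lift i j)) (smoothM sc (smooth_coord (s i)))).
  apply: eq_bigr => l _; congr P; apply/funext => x; apply/funext => u.
  by rewrite /F /K /= fconsS fcons_lift2; congr (_ * _); ring.
rewrite -mulr_sumr expr0 mulr1; congr (_ * _).
have sF0 l : smooth (fun x : 'rV[R]_a => c x * x 0 l * x 0 l).
  exact: (smoothM (smoothM sc (smooth_coord _)) (smooth_coord _)).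
transitivity (P (fun x v => \sum_l 1 * (c x * x 0 l * x 0 l * dx s v))).
  rewrite (Pl _ _ _ _ (fun=> dx s) sF0 (fun=> dx_alternating s)).
  apply: eq_bigr => l _; rewrite mul1r; congr P; apply/funext => x; apply/funext => v.
  rewrite /F /K /= fcons0; congr (_ * dx _ _).
  by apply/funext => j; rewrite fconsS.
congr P; apply/funext => x; apply/funext => v.
by rewrite /nsq mulr_sumr mulr_suml; apply: eq_bigr => l _; ring.
Qed.
End Sphere.

Section Pair.
Variables (a b p q : nat) (la : R) (P : functional R a p.+1) (Q : functional R b q).
Variable DQ : set ('rV[R]_b -> R).
Hypotheses (la0 : 0 < la) (sP : sphere_cycle la P) (tQ : tame Q DQ).

(* The test form is [c d(|x_0|^2) /\ dx_I /\ dx_J / 2], where P and Q do not vanish on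
   [al dx_I] and [be dx_J], and [c] concentrates the cone at parameters [t] near [rho]. *)
Lemma cone_nonzero (e : R) : 0 < e ->
  exists w : dform R (a + b) (1 + (p.+1 + q)), [/\ smooth_form w,
    forall z v, e <= `|z| -> w z v = 0 & cone (cross P Q) w != 0].
Proof.
move=> e0; have tP := sphere_tame sP.
have Pl := tame_linear tP; have Ql := tame_linear tQ.
have [al [sI [sal [r0 al0] G0c G01]]] := tame_nonzero tP.
have [be [sJ [Dbe [r1 be0] G1c G11]]] := tame_nonzero tQ.
pose G0 (t : R) := P (fun x v => al (t *: x) * dx sI v).
pose G1 (t : R) := Q (fun x v => be (t *: x) * dx sJ v).
have E0 : G0 1 != 0.
  rewrite (_ : G0 1 = P (fun x v => al x * dx sI v))//.
  by congr P; apply/funext => x; apply/funext => v; rewrite scale1r.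
have E1 : G1 1 != 0.
  rewrite (_ : G1 1 = Q (fun x v => be x * dx sJ v))//.
  by congr Q; apply/funext => x; apply/funext => v; rewrite scale1r.
(* As a factor of the test form, k fixes the sign: k G0(t) G1(t) is k^2 > 0 at t = 1, hence positive
   nearby. *)
pose k := G0 1 * G1 1; have k2 : 0 < k * k.
  by rewrite -expr2 exprn_even_gt0//= mulf_neq0.
have [d d0 Hd] : exists2 d : R, 0 < d & forall t, `|t - 1| < d -> 0 < k * (G0 t * G1 t).
  have H : \forall t \near (1 : R), 0 < k * (G0 t * G1 t).
    have ct : k * (G0 t * G1 t) @[t --> (1 : R)] --> k * (G0 1 * G1 1).
      by apply: cvgM; [exact: cvg_cst|apply: cvgM; [exact: G0c|exact: G1c]].
    by apply: (cvgr_gt _ ct).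
  have /nbhs_normP[d /= d0 Hd] := H.
  by exists d => // t td; apply: Hd; rewrite /ball_/= distrC.
(* Both al and be vanish at points of norm at least rr, so their dilates by 1/rho vanish at points
   of norm at least e. *)
pose rr := `|r0| + `|r1| + 1; have rr0 : 0 < rr by rewrite ltr_wpDl// addr_ge0.
pose rho := e / rr; have rho0 : 0 < rho by rewrite divr_gt0.
(* If |t/rho - 1| >= d and t >= 0, then (t^2 - rho^2)^2 = (t - rho)^2 (t + rho)^2 >= d^2 rho^4, and
   C la^4 d^2 rho^4 = 2 is where the plateau reaches 0. *)
pose C := 2 / (d ^+ 2 * rho ^+ 4 * la ^+ 4).
pose eta (s : R) := plateau (C * (s - rho ^+ 2 * la ^+ 2) ^+ 2).
pose c0 (x : 'rV[R]_a) := k * eta (nsq x) * al (rho^-1 *: x).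
pose c1 (y : 'rV[R]_b) := be (rho^-1 *: y).
have sc0 : smooth c0.
  have s1 : smooth (fun x : 'rV[R]_a => nsq x - rho ^+ 2 * la ^+ 2).
    exact: (smoothB (@smooth_nsq R a) (smooth_cst _)).
  have s2 : smooth (fun x : 'rV[R]_a => eta (nsq x)).
    apply: smooth_plateau; apply: smoothZ; under eq_fun do rewrite expr2.
    exact: (smoothM s1 s1).
  exact: (smoothM (smoothZ k s2) (smooth_dilation rho^-1 sal)).
have Dc1 : DQ c1 by exact: (tame_dilation tQ rho^-1 Dbe).
have sc1 := tame_smooth tQ Dc1.
pose w : dform R (a + b) (1 + (p.+1 + q)) := fun z v =>
  \sum_(l < a) 1 * (c0 (lsubmx z) * c1 (rsubmx z) * z 0 (lshift b l) * dx (fcat (fcons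
    l sI) sJ) v).
exists w; split.
- apply: (@smooth_form_sum R _ _ _ _ (fun=> 1) (fun l (z : 'rV[R]_(a + b)) =>
  c0 (lsubmx z) * c1 (rsubmx z) * z 0 (lshift b l))
    (fun l => dx (fcat (fcons l sI) sJ))) => l; last exact: dx_alternating.
  have s1 : smooth (fun z : 'rV[R]_(a + b) =>
    c0 (lsubmx z)) by exact: (smooth_lsubmx sc0).
  have s2 : smooth (fun z : 'rV[R]_(a + b) =>
    c1 (rsubmx z)) by exact: (smooth_rsubmx sc1).
  exact: (smoothM (smoothM s1 s2) (smooth_coord _)).
- move=> z v ez; rewrite /w big1// => l _.
  have far (r : R) n (x : 'rV[R]_n) : r < rr -> e <= `|x| -> r < `|rho^-1 *: x|.
    move=> rrr ex; rewrite normrZ gtr0_norm ?invr_gt0// /rho invf_div.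
    by rewrite (lt_le_trans rrr)// mulrAC ler_pdivlMr// ler_wpM2l// ltW.
  have [le|re] := norm_split_ge ez.
    have h : r0 < rr.
      by rewrite /rr (le_lt_trans (ler_norm r0))// -addrA ltrDl ltr_wpDl.
    by rewrite /c0 (al0 _ (far _ _ _ h le)) !(mulr0, mul0r).
  have h : r1 < rr.
    by rewrite /rr (le_lt_trans (ler_norm r1))// addrAC ltrDr ltr_wpDl.
  by rewrite /c1 (be0 _ (far _ _ _ h re)) !(mulr0, mul0r).
(* The integrand of the cone at t: t^(p+1) and t^q come from the scaled vectors in dx_I and dx_J, t
   from the coordinate factor, and la^2 is |x|^2 on the sphere of P. *)
pose H (t : R) := t ^+ p.+1 * (t * t ^+ q * la ^+ 2 * eta (t ^+ 2 * la ^+ 2) *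
  (k * (G0 (rho^-1 * t) * G1 (rho^-1 * t)))).
have wH (t : R) : cross P Q (fun z v => w (t *: z) (col_mx z (t *: v) :
  'M[R]_(1 + (p.+1 + q), a + b))) = H t.
  pose K := t * t ^+ q * G1 (rho^-1 * t).
  have sK : smooth (fun x : 'rV[R]_a => K * c0 (t *: x)).
    exact: (smoothZ K (smooth_dilation t sc0)).
  transitivity (P (fun x u => \sum_l K * c0 (t *: x) * x 0 l *
      dx (fcons l sI) (col_mx x (t *: u) : 'M[R]_(1 + p.+1, a)))).
    congr P; apply/funext => x; apply/funext => u.
    pose A := \sum_l c0 (t *: x) * (t * x 0 l) * dx (fcons l sI) (col_mx x (t *: u) :
      'M[R]_(1 + p.+1, a)).
    transitivity (Q (fun y u' => (A * t ^+ q) * (be ((rho^-1 * t) *: y) * dx sJ u'))).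
      congr Q; apply/funext => y; apply/funext => u'.
      rewrite /w /A mulr_suml mulr_suml; apply: eq_bigr => l _.
      rewrite mul1r !linearZ /= row_mxKl row_mxKr mxE row_mxEl scale_block_mx !scaler0.
      by rewrite dx_cone_block dxZ /c1 scalerA; ring.
    have Db := tame_dilation tQ (rho^-1 * t) Dbe.
    rewrite (linear_onZ _ Ql Db (dx_alternating sJ)) /A !mulr_suml; apply: eq_bigr => l _.
    by rewrite /K /G1; ring.
  rewrite (sphere_radial_cone sP sI t sK) /H; congr (_ * _).
  pose K0 := K * k * eta (t ^+ 2 * la ^+ 2) * la ^+ 2.
  have ads := @dx_alternating R _ _ sI.
  have sal' := smooth_dilation (rho^-1 * t) sal.
  transitivity (P (fun x u => K0 * (al ((rho^-1 * t) *: x) * dx sI u))); last first.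
    rewrite (linear_onZ _ Pl sal' ads) -[P _]/(G0 (rho^-1 * t)) /K0 /K.
    ring.
  have sm := smoothM sK (@smooth_nsq R a).
  have sm' := smoothZ K0 sal'.
  transitivity (P (fun x u => (K0 * al ((rho^-1 * t) *: x)) * dx sI u)).
    apply: (sphere_eq sP sm sm' ads) => x xS.
    by rewrite /c0 nsqZ xS scalerA /K0; ring.
  by congr P; apply/funext => x; apply/funext => u; rewrite mulrA.
apply: lt0r_neq0; rewrite coneE.
have -> : \int[@lebesgue_measure R]_(t in `[0, +oo[)
    cross P Q (fun z v => w (t *: z) (col_mx z (t *: v) : 'M[R]_(1 + (p.+1 + q),
      a + b))) =
    \int[@lebesgue_measure R]_(t in `[0, +oo[) H t.
  by congr (Rintegral _ _ _); apply/funext => t; exact: wH.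
have D0 : 0 < d ^+ 2 * rho ^+ 4 * la ^+ 4.
  exact: (mulr_gt0 (mulr_gt0 (exprn_gt0 _ d0) (exprn_gt0 _ rho0)) (exprn_gt0 _ la0)).
have eta0 (t : R) : 0 <= t -> d <= `|rho^-1 * t - 1| -> eta (t ^+ 2 * la ^+ 2) = 0.
  move=> t0 dt; apply: plateau0.
  have dr : d * rho <= `|t - rho|.
    rewrite -ler_pdivlMr//; apply: le_trans dt _.
    by rewrite -[X in _ / X](gtr0_norm rho0) -normfV -normrM mulrBl divff ?gt_eqF// mulrC.
  have h1 : (d * rho) ^+ 2 <= (t - rho) ^+ 2.
    rewrite -[(t - rho) ^+ 2](real_normK (num_real _)).
    by apply: lerXn2r => //; rewrite nnegrE; exact: (ltW (mulr_gt0 d0 rho0)).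
  have h2 : rho ^+ 2 <= (t + rho) ^+ 2.
    by apply: lerXn2r; rewrite ?nnegrE ?(addr_ge0 t0 (ltW rho0)) ?(ltW rho0)// lerDr.
  have -> : (t ^+ 2 * la ^+ 2 - rho ^+ 2 * la ^+ 2) ^+ 2 =
     la ^+ 4 * ((t - rho) ^+ 2 * (t + rho) ^+ 2) by ring.
  rewrite /C mulrAC ler_pdivlMr// ler_wpM2l//.
  have -> : d ^+ 2 * rho ^+ 4 * la ^+ 4 = la ^+ 4 * ((d * rho) ^+ 2 * rho ^+ 2) by ring.
  by rewrite ler_wpM2l ?exprn_ge0 ?(ltW la0)// ler_pM ?sqr_ge0.
apply: (@Rintegral_halfline_gt0 H rho (rho * (1 + d))).
- have cM (f g : R -> R) : continuous f -> continuous g -> continuous (fun t =>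
  f t * g t).
    by move=> fc gc t; apply: cvgM; [exact: fc|exact: gc].
  have cX n : continuous (fun t : R => t ^+ n) by exact: exprn_continuous.
  have cc (c : R) : continuous (fun _ : R => c) by exact: cst_continuous.
  have cl : continuous (fun t : R => rho^-1 * t) by exact: mulrl_continuous.
  have ceta : continuous (fun t : R => eta (t ^+ 2 * la ^+ 2)).
    have ci : continuous (fun t : R => C * (t ^+ 2 * la ^+ 2 - rho ^+ 2 * la ^+ 2) ^+ 2).
      apply: (cM (fun=> C)) => //.
      have c1' : continuous (fun t : R => t ^+ 2 * la ^+ 2 - rho ^+ 2 * la ^+ 2).
        by move=> t; apply: cvgB; [exact: (cM _ _ (cX 2) (cc _))|exact: cvg_cst].
      exact: (cM _ _ c1' c1').
    by move=> t; apply: (continuous_comp (ci t)); exact: continuous_plateau.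
  have cG0 : continuous (fun t => G0 (rho^-1 * t)).
    by move=> t; apply: (continuous_comp (cl t)); exact: G0c.
  have cG1 : continuous (fun t => G1 (rho^-1 * t)).
    by move=> t; apply: (continuous_comp (cl t)); exact: G1c.
  apply: (cM _ _ (cX p.+1)); apply: (cM _ _);
    last exact: (cM _ _ (cc k) (cM _ _ cG0 cG1)).
  apply: (cM _ _ _ ceta); apply: (cM _ _ _ (cc _)); apply: (cM _ _ _ (cX q)).
  exact: (cX 1).
- move=> t t0; have [dt|dt] := leP d `|rho^-1 * t - 1|.
    by rewrite /H (eta0 _ t0 dt) mulr0 mul0r mulr0.
  have := Hd _ dt => /ltW kG.
  apply: (mulr_ge0 (exprn_ge0 _ t0) (mulr_ge0 (mulr_ge0 (mulr_ge0 _ _) (plateau_ge0 _))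
    kG)).
    exact: (mulr_ge0 t0 (exprn_ge0 _ t0)).
  exact: sqr_ge0.
- move=> t rt; rewrite /H eta0 ?mulr0 ?mul0r ?mulr0//.
    by rewrite (le_trans _ rt)// mulr_ge0 ?(ltW rho0)// addr_ge0 ?(ltW d0).
  by rewrite (le_trans _ (ler_norm _))// lerBrDl ler_pdivlMl.
- exact: rho0.
- rewrite /H mulVf ?gt_eqF// /eta subrr expr0n /= mulr0 plateau1// mulr1.
  apply: (mulr_gt0 (exprn_gt0 _ rho0) (mulr_gt0 (mulr_gt0 (mulr_gt0 rho0 _) _) k2)).
    exact: exprn_gt0.
  exact: exprn_gt0.
Qed.
End Pair.
End ConeNonzero.

(** * Calibrations *)

Section Calibration.
Variable R : realType.
Implicit Types N m : nat.

(** Duality of dx_I with the basis m-vectors: if J differs from I, an element of J outside I, which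
    exists as the sizes agree, gives a zero row of the minor. *)
Lemma pairing_dx N m (I : subm N m) (xi : mvec R N m) :
  pairing (dx (fun a : 'I_m => enum_val (cast_ord (esym (eqP (valP I))) a))) xi = xi I.
Proof.
rewrite /pairing (bigD1 I)//= [X in _ + X]big1 ?addr0 => [|J JI].
  rewrite /dx (_ : colsub _ _ = 1%:M) ?det1 ?mulr1//.
  apply/matrixP => i j; rewrite !mxE; congr (_%:R); congr nat_of_bool.
  by rewrite (inj_eq enum_val_inj) (inj_eq (@cast_ord_inj _ _ _)).
have [x xJ xI] : exists2 x, x \in val J & x \notin val I.
  apply/subsetPn; apply: contraNN JI => JI; apply/eqP/val_inj/eqP.
  by rewrite eqEcard JI (eqP (valP I)) (eqP (valP J)) /=.
pose i : 'I_m := cast_ord (eqP (valP J)) (enum_rank_in xJ x).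
rewrite /dx (expand_det_row _ i) big1 ?mulr0// => j _.
rewrite !mxE cast_ordK enum_rankK_in//.
rewrite (_ : (x == _) = false) ?mul0r//; apply/negbTE.
by apply: contraNneq xI => ->; exact: enum_valP.
Qed.

(** The value 1 excludes the default value 0 of [sup], so the set of pairings is bounded and can be
    tested on the covectors dx_I divided by 1 + comass. *)
Lemma mass_norm_coord N m : exists2 K : R, 0 < K &
  forall xi : mvec R N m, mass_norm xi = 1 -> forall I, `|xi I| <= K.
Proof.
pose f (I : subm N m) := @dx R m N (fun a => enum_val (cast_ord (esym (eqP (valP I))) a)).
exists (1 + \sum_I comass (f I)) => [|xi xi1 I].
  by rewrite ltr_pwDl// sumr_ge0// => I _; exact: comass_ge0.
have [ne [M ub]] : has_sup [set pairing f xi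
      | f in [set f : 'M[R]_(m, N) -> R | alternating f /\ comass f <= 1]].
  apply: contrapT => /sup_out E; move: xi1; rewrite /mass_norm E => /eqP.
  by rewrite eq_sym oner_eq0.
have c0 : 0 <= comass (f I) by exact: comass_ge0.
apply: (@le_trans _ _ (1 + comass (f I))); last first.
  by rewrite lerD2l (bigD1 I)//= lerDl sumr_ge0// => J _; exact: comass_ge0.
have H (a : R) : `|a| <= 1 -> a * xi I <= 1 + comass (f I).
  move=> a1; have k0 : 0 < 1 + comass (f I) by rewrite ltr_pwDl.
  rewrite -[leRHS]mulr1 -ler_pdivrMl// mulrA.
  set b := (1 + comass (f I))^-1 * a.
  have -> : b * xi I = pairing (fun v => b * f I v) xi.
    rewrite -[xi I in LHS]pairing_dx /pairing mulr_sumr.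
    by apply: eq_bigr => J _; rewrite mulrCA.
  rewrite -xi1; apply: ub_le_sup; first by exists M.
  exists (fun v => b * f I v) => //; split; first exact/alternatingZ/dx_alternating.
  apply: le_trans (comassZ_le _ _) _; rewrite /b normrM gtr0_norm ?invr_gt0//.
  rewrite -mulrA ler_pdivrMl// mulr1; apply: (@le_trans _ _ (comass (f I))).
    by rewrite ler_piMl.
  by rewrite lerDr.
rewrite ler_norml; apply/andP; split.
  by rewrite lerNl -mulN1r H// normrN1.
by rewrite -[xi I]mul1r H// normr1.
Qed.

Lemma measurable_borelRn N (f : 'rV[R]_N -> R) :
  continuous f -> measurable_fun setT (f : borelRn R N -> R).
Proof.
move=> fc; apply: (@measurability _ _ (borelRn R N) (measurableTypeR R) setT f
  (@RGenOInfty.G R)).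
  exact: RGenOInfty.measurableE.
move=> _ [_ [r ->] <-]; rewrite setTI; apply: sub_sigma_algebra.
by apply: open_comp => [x _|]; [exact: fc|exact: rray_open].
Qed.

Lemma measurable_pairing N m (w : dform R N m) (xi : 'rV[R]_N -> mvec R N m) :
  (forall v, continuous (fun x => w x v)) ->
  (forall I, measurable_fun setT (fun x : borelRn R N => xi x I)) ->
  measurable_fun setT (fun x : borelRn R N => pairing (w x) (xi x)).
Proof.
move=> wc mxi; rewrite /pairing; apply: measurable_sum => I.
by apply: measurable_funM => //; exact: measurable_borelRn.
Qed.

(** The measure-theoretic part. Both families of test forms are needed at every scale: the first is
    used where phi is close to phi_0, the second inside the ball where the resulting cutoff is 1. *)
Lemma not_calibrates N m (S : functional R N m) (phi : dform R N m) :
  continuous_form phi ->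
  (forall e : R, 0 < e -> exists g, [/\ smooth g, cutoff e g &
     S (fun z v => g z * phi 0 v) = 0]) ->
  (forall e : R, 0 < e -> exists w : dform R N m, [/\ smooth_form w,
     forall z v, e <= `|z| -> w z v = 0 & S w != 0]) ->
  ~ calibrates phi S.
Proof.
move=> [pa pc] HA HB [mu [xi [[muK mxi mn1 polar] cal]]].
have [K K0 xiK] := mass_norm_coord N m.
have aeF : Filter (nbhs (almost_everywhere mu)) by exact: ae_filter_ringOfSetsType.
pose n : R := \sum_(I : subm N m) 1.
have n0 : 0 <= n by apply: sumr_ge0.
(* As n counts the basis m-vectors and K bounds the coordinates of xi, the pairings with phi and
   phi_0 differ on this ball by at most n K / (2 K (n + 1)) <= 1/2. *)
have [e e0 He] : exists2 e : R, 0 < e & forall z, `|z| < e -> forall I : subm N m,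
    `|phi z (basis_frame R I) - phi 0 (basis_frame R I)| <= (2 * K * (n + 1))^-1.
  have k0 : 0 < (2 * K * (n + 1))^-1.
    by rewrite invr_gt0 !mulr_gt0// ltr_wpDl.
  pose F (I : subm N m) (z : 'rV[R]_N) :=
    `|phi z (basis_frame R I) - phi 0 (basis_frame R I)| <= (2 * K * (n + 1))^-1.
  have H : \forall z \near (0 : 'rV[R]_N), forall I, F I z.
    apply: (@filter_forall _ (subm N m) F (nbhs (0 : 'rV[R]_N))) => I.
    have c : phi z (basis_frame R I) @[z --> (0 : 'rV[R]_N)] --> phi 0 (basis_frame R I).
      exact: pc.
    move/cvgrPdist_le : c => /(_ _ k0); apply: filterS => z.
    by rewrite /F distrC.
  have /nbhs_normP[d /= d0 Hd] := H.
  by exists d => // z zd; apply: Hd; rewrite /ball_/= sub0r normrN.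
have [g [sg [g01 [d d0 gd] ge] Sg]] := HA e e0.
have gc := smooth_continuous sg.
pose f x := g x * pairing (phi 0) (xi x).
have fE x : pairing (fun v => g x * phi 0 v) (xi x) = f x.
  by rewrite /pairing /f mulr_sumr; apply: eq_bigr => I _; rewrite mulrCA.
have mf : measurable_fun setT (fun x : borelRn R N => (f x)%:E).
  apply/measurable_EFinP; apply: measurable_funM; first exact: measurable_borelRn.
  by apply: measurable_pairing => // v; exact: cst_continuous.
have f_ge : {ae mu, forall x, g x / 2 <= f x}.
  apply: filterS2 mn1 cal => x x1 xcal.
  have [ex|xe] := leP e `|x|; first by rewrite /f ge// !mul0r.
  have /andP[gx0 gx1] := g01 x.
  rewrite /f ler_wpM2l//.
  have : `|pairing (phi x) (xi x) - pairing (phi 0) (xi x)| <= 2^-1.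
    rewrite /pairing -sumrB; apply: le_trans (ler_norm_sum _ _ _) _.
    apply: (@le_trans _ _ (\sum_(I : subm N m) K * (2 * K * (n + 1))^-1)).
      by apply: ler_sum => I _; rewrite -mulrBr normrM ler_pM// ?xiK// He.
    rewrite (_ : \sum_(I : subm N m) _ = n * (K * (2 * K * (n + 1))^-1)); last first.
      by rewrite mulr_suml; apply: eq_bigr => I _; rewrite mul1r.
    have -> : n * (K * (2 * K * (n + 1))^-1) = n / (n + 1) * 2^-1.
      have n1 : n + 1 != 0 by rewrite gt_eqF// ltr_wpDl.
      by field; rewrite n1 gt_eqF.
    by rewrite ler_piMl// ler_pdivrMr ?ltr_wpDl// mul1r lerDl.
  rewrite xcal ler_norml => /andP[_]; lra.
have f_ge0 : {ae mu, forall x, 0 <= f x}.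
  by apply: filterS f_ge => x; apply: le_trans; rewrite divr_ge0//; have /andP[] := g01 x.
pose B : set 'rV[R]_N := [set x | `|x| <= e].
have mB : measurable (B : set (borelRn R N)).
  rewrite -[B]setCK; apply: measurableC; apply: sub_sigma_algebra.
  rewrite openC /B (_ : [set _ | _] = Num.norm @^-1` [set t : R | t <= e])//.
  by apply: closed_comp => [x _|]; [exact: norm_continuous|exact: closed_le].
have intf : (\int[mu]_x (f x)%:E = \int[mu]_x `|(f x)%:E|)%E.
  apply: ae_eq_integral => //; first exact: measurableT_comp.
  by apply: filterS f_ge0 => x fx _; rewrite /= ger0_norm.
have [M M0 fM] : exists2 M : R, 0 <= M & {ae mu, forall x, `|f x| <= M}.
  exists (\sum_(I : subm N m) K * `|phi 0 (basis_frame R I)|).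
    by apply: sumr_ge0 => I _; rewrite mulr_ge0// ltW.
  apply: filterS mn1 => x x1; have /andP[gx0 gx1] := g01 x.
  rewrite /f normrM ger0_norm//; apply: le_trans (ler_piMl _ gx1) _ => //.
  apply: le_trans (ler_norm_sum _ _ _) _; apply: ler_sum => I _.
  by rewrite normrM ler_wpM2r// xiK.
(* A Rintegral equal to 0 could also stand for an infinite integral, so finiteness comes first: f is
   almost everywhere bounded and vanishes off a ball of finite measure. *)
have int_lty : (\int[mu]_x `|(f x)%:E| < +oo)%E.
  rewrite (_ : (\int[mu]_x `|(f x)%:E|)%E = (\int[mu]_(x in B) `|(f x)%:E|)%E);
    last first.
    rewrite [RHS]integral_mkcond; apply: eq_integral => x _; rewrite /patch.
    case: ifPn => //; rewrite notin_setE /B /= => /negP; rewrite -ltNge => xe.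
    by rewrite /f ge ?ltW// mul0r normr0.
  have fMB : {ae mu, forall x, B x -> (`|(f x)%:E| <= M%:E)%E}.
    by apply: filterS fM => x fx _; rewrite /= lee_fin.
  apply: (@le_lt_trans _ _ (\int[mu]_(x in B) M%:E)%E).
    apply: (ae_ge0_le_integral mB _ _ _ _ fMB) => //.
    - by apply/measurable_funTS; exact: measurableT_comp.
  rewrite integral_cst// lte_mul_pinfty ?lee_fin//.
  by apply: muK; exact: compact_cball.
have f0 : {ae mu, forall x, f x = 0}.
  have Sw : S (fun z v => g z * phi 0 v) = \int[mu]_x f x.
    rewrite polar.
    - by congr (Rintegral _ _ _); apply/funext => x; exact: fE.
    - exact: (smooth_form_cst sg (pa 0)).
    - by exists e => x v ex; rewrite ge ?mul0r// ltW.
  have : (\int[mu]_x `|(f x)%:E|)%E = 0.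
    rewrite Sg /Rintegral intf in Sw.
    have fin : (\int[mu]_x `|(f x)%:E|)%E \is a fin_num.
      by rewrite ge0_fin_numE// integral_ge0.
    by rewrite -(fineK fin) -Sw.
  move=> /(ae_eq_integral_abs mu measurableT mf).
  by apply: filterS => x /(_ I) [].
(* On the ball of radius d, where g = 1, f would be both at least 1/2 and 0; the ball is therefore
   [mu]-null. *)
have g0 : {ae mu, forall x, ~ `|x| <= d}.
  by apply: filterS2 f_ge f0 => x fg fx xd; move: fg; rewrite fx gd//; lra.
have [w [sw w0 /eqP]] := HB d d0; apply.
rewrite polar//; last by exists d => x v dx; rewrite w0// ltW.
have w_ae : ae_eq mu setT (fun x => (pairing (w x) (xi x))%:E) (cst 0%E).
  apply: filterS g0 => x xd _; congr EFin; rewrite /pairing big1// => I _.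
  by rewrite w0 ?mulr0// leNgt; apply/negP => /ltW.
have mw : measurable_fun setT (fun x : borelRn R N => (pairing (w x) (xi x))%:E).
  apply/measurable_EFinP; apply: measurable_pairing => // v.
  by have [_ ws] := sw; exact: (smooth_continuous (ws v)).
rewrite /Rintegral (@ae_eq_integral _ _ _ mu setT (cst 0%E) _ measurableT mw _ w_ae)//.
by rewrite integral0.
Qed.
End Calibration.

Theorem corollary5p2 (R : realType) (n : nat) (hn : (0 < n)%N)
    (N k : 'I_n.+1 -> nat)
    (T : forall i : 'I_n.+1, functional R (N i).+1 (k i).+1)
    (hT0 : normal_current (T ord0))
    (hTi : forall i : 'I_n.+1, i != ord0 -> integral_current (T i))
    (hne : forall i : 'I_n.+1, nonzero_current (T i))
    (hsph : forall i : 'I_n.+1, supported_in (T i) (@unit_sphere R (N i)))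
    (hbd : forall i : 'I_n.+1, cycle_current (T i)) :
  ~ exists phi : dform R (dsum (fun i => (N i).+1))
                        (dsum (fun i => (k i).+1)).+1,
      continuous_calibration phi /\ calibrates phi (cone (minimal_product T)).
Proof.
(* With at least two factors, [cross_family] unfolds to the product of the first factor with the
   family of the others. *)
case: n hn N k T hT0 hTi hne hsph hbd => // n _ N k T hT0 hTi hne hsph hbd.
move=> [phi [[phic _ _] cal]].
have Tc i : is_current (T i).
  have [->|i0] := eqVneq i ord0; first by have [] := hT0.
  by have [[]] := hTi i i0.
pose la (i : 'I_n.+2) : R := Num.sqrt ((k i).+1%:R / (\sum_(j < n.+2) (k j).+1)%N%:R).
have la0 i : 0 < la i.
  rewrite sqrtr_gt0 divr_gt0 ?ltr0n//.
  by rewrite (bigD1 i)//= addSn.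
pose P := dilate (la ord0) (T ord0).
pose Q := cross_family (fun i => dilate (la (lift ord0 i)) (T (lift ord0 i))).
have sP : sphere_cycle (la ord0) P.
  have [_ T0m _] := hT0.
  exact: (sphere_cycle_dilate (Tc _) T0m (hsph _) (hbd _) (hne _) (la0 _)).
have [DQ tQ] : exists D, tame Q D.
  apply: tame_cross_family => i; exists (@smooth R _).
  exact: (tame_dilate (Tc _) (hbd _) (hne _) (la0 _)).
(* [minimal_product T] is [cross P Q] by conversion. *)
apply: (@not_calibrates R _ _ (cone (cross P Q)) phi phic _ _ cal) => e e0.
- by have [phia _] := phic; exact: (cone_cutoff (la0 ord0) sP tQ (phia 0) e0).
- exact: (cone_nonzero (la0 ord0) sP tQ e0).
Qed.
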